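(* Let $q\in\mathbb{C}^*$ not be a root of unity and $n\ge1$. Then the natural map $\mathrm{Aut}(A_q^n)/\mathrm{Inn}(A_q^n)\to\mathrm{Pic}(A_q^n)$, sending $\psi$ to the bimodule $(A_q^n)_\psi$, is an isomorphism.
   Context: $A_q$ is the $\mathbb{C}$-algebra generated by $x^{\pm1},y^{\pm1}$ with $xy=qyx$; $A_q^n=A_q^{\otimes n}$ (tensor product over $\mathbb{C}$). $\mathrm{Inn}$ denotes inner automorphisms; $\mathrm{Pic}$ is the group of invertible bimodules; for $\psi\in\mathrm{Aut}(A)$, $A_\psi$ is $A$ with usual left action and right action twisted by $\psi$. *)

(* Defs.v *)
From mathcomp Require Import all_boot all_algebra complex reals.
Set Implicit Arguments. Unset Strict Implicit. Unset Printing Implicit Defensive.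
Import GRing.Theory.
Local Open Scope ring_scope.

Section Defs.
Variable C : fieldType.

Definition alg_hom (A B : algType C) (f : A -> B) : Prop :=
  [/\ forall (c : C) (u v : A), f (c *: u + v) = c *: f u + f v,
      forall u v : A, f (u * v) = f u * f v
    & f 1 = 1].

Definition alg_aut (A : algType C) (psi : A -> A) : Prop :=
  alg_hom psi /\ bijective psi.

Definition inner_aut (A : algType C) (iota : A -> A) : Prop :=
  exists u v : A, [/\ u * v = 1, v * u = 1 & forall a, iota a = u * a * v].

(* Relations of A_q^{⊗ n}: generators x_i^{±1}, y_i^{±1} (i < n),
   x_i y_i = q y_i x_i, generators with different indices commute. *)
Definition qt_rel (n : nat) (q : C) (A : algType C)
  (x xi y yi : 'I_n -> A) : Prop :=
  [/\ forall i, x i * xi i = 1 /\ xi i * x i = 1,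
      forall i, y i * yi i = 1 /\ yi i * y i = 1,
      forall i, x i * y i = q *: (y i * x i),
      forall i j, i != j ->
        [/\ x i * x j = x j * x i, y i * y j = y j * y i
          & x i * y j = y j * x i]
    & forall i j, i != j -> x i * xi j = xi j * x i /\ y i * yi j = yi j * y i
       /\ xi i * y j = y j * xi i /\ x i * yi j = yi j * x i
       /\ xi i * yi j = yi j * xi i /\ xi i * xi j = xi j * xi i
       /\ yi i * yi j = yi j * yi i].

(* (A, x, xi, y, yi) is the C-algebra presented by the generators and
   relations above (universal property of a presentation), i.e. A ≅ A_q^n. *)
Definition is_quantum_torus (n : nat) (q : C) (A : algType C)
  (x xi y yi : 'I_n -> A) : Prop :=
  qt_rel q x xi y yi /\
  forall (B : algType C) (X Xi Y Yi : 'I_n -> B),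
    qt_rel q X Xi Y Yi ->
    (exists f : A -> B, alg_hom f /\
       forall i, [/\ f (x i) = X i, f (xi i) = Xi i, f (y i) = Y i
                 & f (yi i) = Yi i]) /\
    (forall f g : A -> B, alg_hom f -> alg_hom g ->
       (forall i, [/\ f (x i) = g (x i), f (xi i) = g (xi i),
                      f (y i) = g (y i) & f (yi i) = g (yi i)]) ->
       forall a, f a = g a).

Definition is_bimod (A : algType C) (M : lmodType C)
  (la : A -> M -> M) (ra : M -> A -> M) : Prop :=
  [/\ (forall (c : C) a b m, la (c *: a + b) m = c *: la a m + la b m) /\
      (forall (c : C) a m m', la a (c *: m + m') = c *: la a m + la a m'),
      (forall (c : C) a b m, ra m (c *: a + b) = c *: ra m a + ra m b) /\
      (forall (c : C) a m m', ra (c *: m + m') a = c *: ra m a + ra m' a),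
      (forall m, la 1 m = m /\ ra m 1 = m),
      (forall a b m, la (a * b) m = la a (la b m) /\ ra m (a * b) = ra (ra m a) b)
    & (forall a b m, la a (ra m b) = ra (la a m) b)].

Definition bimod_iso (A : algType C)
  (M : lmodType C) (lM : A -> M -> M) (rM : M -> A -> M)
  (N : lmodType C) (lN : A -> N -> N) (rN : N -> A -> N) : Prop :=
  exists f : M -> N,
    [/\ bijective f,
        forall (c : C) m m', f (c *: m + m') = c *: f m + f m',
        forall a m, f (lM a m) = lN a (f m)
      & forall m b, f (rM m b) = rN (f m) b].

Definition balanced (A : algType C)
  (M : lmodType C) (rM : M -> A -> M)
  (N : lmodType C) (lN : A -> N -> N) (Q : lmodType C) (g : M -> N -> Q) :=
  [/\ forall (c : C) m m' n, g (c *: m + m') n = c *: g m n + g m' n,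
      forall (c : C) m n n', g m (c *: n + n') = c *: g m n + g m n'
    & forall m a n, g (rM m a) n = g m (lN a n)].

(* P ≅ M ⊗_A N as bimodules: there is a balanced bimodule-compatible map
   beta : M x N -> P which is universal among balanced maps (the defining
   universal property of the tensor product over A). *)
Definition tensor_iso (A : algType C)
  (M : lmodType C) (lM : A -> M -> M) (rM : M -> A -> M)
  (N : lmodType C) (lN : A -> N -> N) (rN : N -> A -> N)
  (P : lmodType C) (lP : A -> P -> P) (rP : P -> A -> P) : Prop :=
  exists beta : M -> N -> P,
    [/\ balanced rM lN beta,
        forall a m n, beta (lM a m) n = lP a (beta m n),
        forall m n b, beta m (rN n b) = rP (beta m n) b
      & forall (Q : lmodType C) (g : M -> N -> Q), balanced rM lN g ->
          (exists h : P -> Q,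
             (forall (c : C) p p', h (c *: p + p') = c *: h p + h p') /\
             forall m n, g m n = h (beta m n)) /\
          (forall h h' : P -> Q,
             (forall (c : C) p p', h (c *: p + p') = c *: h p + h p') ->
             (forall (c : C) p p', h' (c *: p + p') = c *: h' p + h' p') ->
             (forall m n, h (beta m n) = h' (beta m n)) ->
             forall p, h p = h' p)].

Definition twl (A : algType C) : A -> A -> A := fun a m => a * m.
Definition twr (A : algType C) (psi : A -> A) : A -> A -> A :=
  fun m b => m * psi b.

Definition invertible_bimod (A : algType C)
  (M : lmodType C) (lM : A -> M -> M) (rM : M -> A -> M) : Prop :=
  exists (N : lmodType C) (lN : A -> N -> N) (rN : N -> A -> N),
    [/\ is_bimod lN rN,
        tensor_iso lM rM lN rN (@twl A) (twr id)
      & tensor_iso lN rN lM rM (@twl A) (twr id)].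

End Defs.

(* Main.v *)
From HB Require Import structures.
Require Import Defs.
From mathcomp Require Import all_boot all_order all_algebra complex reals.
From mathcomp Require Import boolp finmap spectral zify.
Set Implicit Arguments. Unset Strict Implicit. Unset Printing Implicit Defensive.
Import Order.TTheory GRing.Theory Num.Theory.
Local Open Scope ring_scope.

(** Let A be the quantum torus with its basis of monomials e_m, m in Z^(2n).
    It is a simple Ore domain, and the degree in each direction of Z^(2n) is
    additive on products.  An invertible bimodule M is uniform as a left
    module, hence embeds in A as a left ideal, and right multiplication by a
    unit u of A shifts all degrees of elements of M by a constant; since u is
    invertible, the shifts in opposite directions are opposite, so they form a
    vector d(u) of Z^(2n).  For each generator z, the map
    m |-> e_(-d(z)) m z therefore preserves the finite-dimensional spaces of
    elements of M supported in a given box.  These maps commute up to powers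
    of q, hence commute, because q is not a root of unity and they are
    invertible.  A common eigenvector v satisfies v A = A v, and simplicity of
    A makes M free of rank one on (an image of) v; the right action on this
    generator is the automorphism sought. *)

(** * Automorphisms and twisted bimodules *)

Lemma linear_map0 (C : pzRingType) (M N : lmodType C) (f : M -> N) :
  (forall c u v, f (c *: u + v) = c *: f u + f v) -> f 0 = 0.
Proof.
by move=> H; move: (H (- 1) 0 0); rewrite scaler0 addr0 scaleN1r addNr.
Qed.

Lemma linear_mapD (C : pzRingType) (M N : lmodType C) (f : M -> N) :
  (forall c u v, f (c *: u + v) = c *: f u + f v) ->
  forall u v, f (u + v) = f u + f v.
Proof. by move=> H u v; have := H 1 u v; rewrite !scale1r. Qed.

Lemma linear_mapZ (C : pzRingType) (M N : lmodType C) (f : M -> N) :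
  (forall c u v, f (c *: u + v) = c *: f u + f v) ->
  forall c u, f (c *: u) = c *: f u.
Proof. by move=> H c u; have := H c u 0; rewrite (linear_map0 H) !addr0. Qed.

Lemma linear_mapB (C : pzRingType) (M N : lmodType C) (f : M -> N) :
  (forall c u v, f (c *: u + v) = c *: f u + f v) ->
  forall u v, f (u - v) = f u - f v.
Proof.
by move=> H u v; rewrite -scaleN1r addrC H scaleN1r addrC.
Qed.

Section Twists.
Variables (C : fieldType) (A : algType C).

Lemma twist_bimod (psi : A -> A) : alg_hom psi -> is_bimod (@twl _ A) (twr psi).
Proof.
move=> [lin mul one]; rewrite /twl /twr; split.
- by split=> *; [rewrite mulrDl -scalerAl | rewrite mulrDr -scalerAr].
- by split=> *; [rewrite lin mulrDr -scalerAr | rewrite mulrDl -scalerAl].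
- by move=> m; rewrite one mul1r mulr1.
- by move=> a b m; rewrite mul !mulrA.
- by move=> a b m; rewrite mulrA.
Qed.

(** The map [m * psi n] realises the tensor product: balancedness gives [g m n = g (m * psi n) 1],
    so [g] factors through [p |-> g p 1]. *)
Lemma twist_tensor (psi phi chi : A -> A) : alg_hom psi ->
  (forall a, psi (phi a) = chi a) ->
  tensor_iso (@twl _ A) (twr psi) (@twl _ A) (twr phi) (@twl _ A) (twr chi).
Proof.
move=> [lin mul one] comp; exists (fun m n => m * psi n).
rewrite /twl /twr; split.
- split=> *.
  + by rewrite mulrDl -scalerAl.
  + by rewrite lin mulrDr -scalerAr.
  + by rewrite mul mulrA.
- by move=> *; rewrite mulrA.
- by move=> m n b; rewrite mul comp mulrA.
- move=> Q g [glinl _ gbal]; split=> [|h h' _ _ hh' p].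
  + exists (fun p => g p 1); split=> [c p p'|m n]; first exact: glinl.
    by rewrite gbal mulr1.
  + by move: (hh' p 1); rewrite one mulr1.
Qed.

Lemma alg_aut_inv (psi : A -> A) : alg_aut psi ->
  exists phi : A -> A, [/\ alg_aut phi, cancel psi phi & cancel phi psi].
Proof.
move=> [[lin mul one] [phi psiK phiK]]; exists phi; split=> //.
split; last by exists psi.
split=> [c u v|u v|]; apply: (can_inj psiK).
- by rewrite lin !phiK.
- by rewrite mul !phiK.
- by rewrite one phiK.
Qed.

Lemma twist_invertible (psi : A -> A) :
  alg_aut psi -> invertible_bimod (@twl _ A) (twr psi).
Proof.
move=> psi_aut; have [phi [phi_aut psiK phiK]] := alg_aut_inv psi_aut.
exists A, (@twl _ A), (twr phi); split.
- exact: twist_bimod phi_aut.1.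
- exact: twist_tensor psi_aut.1 phiK.
- exact: twist_tensor phi_aut.1 psiK.
Qed.

(** A left linear map is right multiplication by the image [u] of 1, a unit if the map is bijective.
    Right linearity at 1 then reads [psi a * u = u * phi a]. *)
Lemma twist_iso (psi phi : A -> A) : alg_aut psi -> alg_aut phi ->
  bimod_iso (@twl _ A) (twr psi) (@twl _ A) (twr phi) <->
  exists iota : A -> A, inner_aut iota /\ forall a, psi a = iota (phi a).
Proof.
move=> psi_aut phi_aut; rewrite /twl /twr; split.
- move=> [f [[g fK gK] flin fl fr]].
  have fE m : f m = m * f 1 by rewrite -fl mulr1.
  have vu : g 1 * f 1 = 1 by rewrite -fE gK.
  have uv : f 1 * g 1 = 1.
    by apply: (can_inj fK); rewrite [LHS]fE -mulrA vu mulr1.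
  exists (fun a => f 1 * a * g 1); split; first by exists (f 1), (g 1).
  move=> a; have := fr 1 a; rewrite mul1r (fE (psi a)) => <-.
  by rewrite -mulrA uv mulr1.
- move=> [iota [[u [v [uv vu iotaE]]] psiE]].
  exists (fun m => m * u); split.
  + by exists (fun m => m * v) => m; rewrite -mulrA ?uv ?vu mulr1.
  + by move=> c m m'; rewrite mulrDl scalerAl.
  + by move=> a m; rewrite mulrA.
  + by move=> m b; rewrite psiE iotaE -!mulrA vu mulr1.
Qed.

End Twists.

(** * Bases of q-commuting monomials *)

Definition qsim (C : fieldType) (q : C) (M : lmodType C) (a b : M) : Prop :=
  exists l : int, a = q ^ l *: b.

Definition is_ideal (A : nzRingType) (J : A -> Prop) : Prop :=
  [/\ forall a b, J a -> J b -> J (a + b),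
      forall a b, J a -> J (b * a)
    & forall a b, J a -> J (a * b)].

(** A matrix with more rows than columns has a nonzero left kernel. This yields the Ore multiples
    and bounds the size of free families. *)
Lemma linear_dependency (F : fieldType) (U T : finType) (G : U -> T -> F) :
  (#|T| < #|U|)%N ->
  exists w : U -> F, (exists u, w u != 0) /\ forall t, \sum_u w u * G u t = 0.
Proof.
move=> ltTU; pose K := \matrix_(i < #|U|, j < #|T|) G (enum_val i) (enum_val j).
have : kermx K != 0.
  rewrite -mxrank_eq0 mxrank_ker -lt0n subn_gt0.
  exact: leq_ltn_trans (rank_leq_col _) ltTU.
move=> /rowV0Pn[v /sub_kermxP vK v0].
exists (fun u => v 0 (enum_rank u)); split.
  move: v0 => /rV0Pn[i vi]; exists (enum_val i); by rewrite enum_valK.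
move=> t; have := congr1 (fun X : 'rV_#|T| => X 0 (enum_rank t)) vK.
rewrite /K !mxE => vK0; rewrite -[RHS]vK0.
rewrite (reindex _ (onW_bij _ (@enum_rank_bij U))) /=.
by apply: eq_bigr => u _; rewrite !mxE !enum_rankK.
Qed.

(** Widening a cube of side [L] by a fixed margin [s] changes its volume by a factor tending to 1 as
    [L] grows; the Ore argument needs this factor below 2. *)
Lemma expn_add_lt_double (s N : nat) :
  exists L, (0 < L)%N /\ ((L + s) ^ N < 2 * L ^ N)%N.
Proof.
(* This is [(1 + s/L)^N <= 1 + c s/L] for [s <= L], cleared of denominators; the recursion
   [c |-> 2c + 1] gives [c = 2^N - 1]. *)
have [c cP] : exists c, forall L, (s <= L)%N ->
    (L * (L + s) ^ N <= L ^ N * (L + c * s))%N.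
  elim: N => [|N [c IH]]; first by exists 0%N => L _; rewrite !expn0; lia.
  exists (2 * c + 1)%N => L sL; rewrite !expnS.
  have h1 := IH L sL.
  apply: leq_trans (_ : (L ^ N * (L + c * s) * (L + s) <= _)%N).
    by rewrite mulnCA mulnC leq_mul2r h1 orbT.
  rewrite [(L * L ^ N)%N]mulnC -!mulnA leq_mul2l; apply/orP; right.
  have : (c * s * s <= c * s * L)%N by rewrite leq_mul2l sL orbT.
  nia.
(* This [L] satisfies both [s <= L] and [c * s < L], so that [L + c * s < 2 * L]. *)
exists (c * s + s + 1)%N; split; first by rewrite addn1.
set L := (c * s + s + 1)%N.
have L0 : (0 < L)%N by rewrite /L addn1.
rewrite -(ltn_pmul2l L0).
apply: leq_ltn_trans (cP L _) _; first by rewrite /L; lia.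
rewrite mulnCA [(L * L ^ N)%N]mulnC mulnCA ltn_pmul2l ?expn_gt0 ?L0 //.
by rewrite /L; lia.
Qed.

Section Monomials.
Variables (C : fieldType) (A : algType C) (q : C) (N : nat).
Local Notation Gam := {ffun 'I_N -> int}.
Variable e : Gam -> A.
Hypothesis q_neq0 : q != 0.
Hypothesis q_nroot : forall k : nat, (0 < k)%N -> q ^+ k != 1.
Hypothesis e0 : e 0 = 1.
Hypothesis eM : forall m k, qsim q (e m * e k) (e (m + k)).
Hypothesis e_conj : forall i, exists g (s : int), s != 0 /\
  forall m, e g * e m = q ^ (s * m i) *: (e m * e g).
Hypothesis e_span : forall a, exists (S : {fset Gam}) (f : Gam -> C),
  a = \sum_(m <- S) f m *: e m.

Lemma expz_q_eq1 (l : int) : q ^ l = 1 -> l = 0.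
Proof.
case: l => [[|k]|k] //.
- by move=> /eqP; rewrite -exprnP (negPf (q_nroot _)).
- by move=> /eqP; rewrite /exprz invr_eq1 (negPf (q_nroot _)).
Qed.

Lemma expz_q_inj : injective (fun l : int => q ^ l).
Proof.
move=> k l /= /(congr1 (fun x => x * q ^ (- l))).
rewrite -!expfzDr // subrr expr0z => /expz_q_eq1/eqP.
by rewrite subr_eq0 => /eqP.
Qed.

Lemma e_unit m : exists u, u * e m = 1 /\ e m * u = 1.
Proof.
have [l lE] := eM (- m) m; have [k kE] := eM m (- m).
rewrite addNr e0 in lE; rewrite subrr e0 in kE.
have qK (j : int) : q ^ (- j) *: (q ^ j *: (1 : A)) = 1.
  by rewrite scalerA -expfzDr // addNr expr0z scale1r.
set u := q ^ (- l) *: e (- m); set v := q ^ (- k) *: e (- m).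
have um : u * e m = 1 by rewrite -scalerAl lE qK.
have mv : e m * v = 1 by rewrite -scalerAr kE qK.
exists u; split => //.
suff -> : u = v by [].
by rewrite -[u]mulr1 -mv mulrA um mul1r.
Qed.

Lemma e_neq0 m : e m != 0.
Proof.
have [u [um _]] := e_unit m; apply/eqP => em0; move: um => /eqP.
by rewrite em0 mulr0 eq_sym oner_eq0.
Qed.

(* Conjugating by a monomial and subtracting a multiple kills a prescribed
   monomial and no other, so an element of an ideal with the smallest
   possible support is a monomial. *)
Lemma ideal_sum_monomials (J : A -> Prop) : is_ideal J ->
  forall (s : seq Gam) (f : Gam -> C), uniq s -> has (fun m => f m != 0) s ->
  J (\sum_(m <- s) f m *: e m) -> J 1.
Proof.
move=> [JD JMl JMr].
have JZ c a : J a -> J (c *: a).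
  by move=> Ja; rewrite -[a]mul1r scalerAl; apply: JMl.
elim=> [//|m0 s IH] f /= /andP[m0s us].
(* Either [m] is a second monomial with nonzero coefficient, or only [m0] survives and one divides
   by its coefficient and by the unit [e m0]. *)
case: (boolP (has _ s)) => [/hasP[m ms fm] _|]; last first.
  move=> /hasPn f0; rewrite orbF => fm0.
  rewrite big_cons [X in _ + X]big1_seq ?addr0; last first.
    by move=> m /= ms; rewrite (eqP (negbNE (f0 m ms))) scale0r.
  have [u [um _]] := e_unit m0.
  move=> /(JMl _ (f m0)^-1%:A)/(JMl _ u).
  by rewrite -scalerAl mul1r scalerA mulVf // scale1r um.
have [i mi] : exists i, m i != m0 i.
  apply/existsP; rewrite -negb_forall; apply: contra m0s => /forallP H.
  suff -> : m0 = m by [].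
  by apply/ffunP => i; rewrite (eqP (H i)).
have [g [eps [eps0 gE]]] := e_conj i.
have [u [ug gu]] := e_unit g.
(* Conjugation by [e g] scales [e k] by [q ^ (eps * k i)]. Subtracting [q ^ (eps * m0 i)] times the
   element kills [m0] but keeps [m], as [m i] and [m0 i] differ. *)
pose f' k := f k * (q ^ (eps * k i) - q ^ (eps * m0 i)).
move=> Ja; apply: (IH f') => //.
  apply/hasP; exists m => //; rewrite mulf_neq0 // subr_eq0.
  by apply: contra mi => /eqP/expz_q_inj/(mulfI eps0) ->.
have -> : \sum_(k <- s) f' k *: e k =
  e g * (\sum_(k <- m0 :: s) f k *: e k) * u +
  (- q ^ (eps * m0 i)) *: (\sum_(k <- m0 :: s) f k *: e k).
  transitivity (\sum_(k <- m0 :: s) f' k *: e k).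
    by rewrite big_cons /f' subrr mulr0 scale0r add0r.
  rewrite mulr_sumr mulr_suml scaler_sumr -big_split; apply: eq_bigr => k _ /=.
  rewrite -scalerAr gE -!scalerAl -mulrA gu mulr1 !scalerA -scalerDl.
  by congr (_ *: _); rewrite /f' mulrBr mulNr [in X in _ - X]mulrC.
by apply: JD; [apply/JMr/JMl | apply: JZ].
Qed.

Lemma quantum_torus_simple (J : A -> Prop) (a : A) :
  is_ideal J -> J a -> a != 0 -> J 1.
Proof.
have [S [f ->]] := e_span a => J_ideal Ja sum0.
apply: (ideal_sum_monomials J_ideal) Ja; first exact: fset_uniq.
apply: contraR sum0 => /hasPn f0; rewrite big1_seq // => m /= mS.
by rewrite (eqP (negbNE (f0 m mS))) scale0r.
Qed.

(** A nontrivial relation would be a combination lying in the zero ideal, which would then contain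
    1. *)
Lemma monomials_free (s : seq Gam) (f : Gam -> C) : uniq s ->
  \sum_(m <- s) f m *: e m = 0 -> forall m, m \in s -> f m = 0.
Proof.
move=> us sum0 m ms; apply/eqP; apply: contraT => fm.
have : (1 : A) = 0.
  apply: (@ideal_sum_monomials (fun a => a = 0) _ s f) => //.
  - by split=> [a b -> ->|a b ->|a b ->]; rewrite ?addr0 ?mulr0 ?mul0r.
  - by apply/hasP; exists m.
by move/eqP; rewrite oner_eq0.
Qed.

(** * Coefficients in the monomial basis *)

Let dom (a : A) : {fset Gam} := projT1 (cid (e_span a)).
(** [e_span] only provides some expansion, so one is chosen; by [cfE] the coefficients do not depend
    on the choice. *)
Definition cf (a : A) (m : Gam) : C :=
  if m \in dom a then projT1 (cid (projT2 (cid (e_span a)))) m else 0.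

Lemma sum_fset_widen (S T : {fset Gam}) (f : Gam -> C) : (S `<=` T)%fset ->
  \sum_(m <- S) f m *: e m =
  \sum_(m <- T) (if m \in S then f m else 0) *: e m.
Proof.
move=> ST; rewrite -[RHS](big_fset_incl _ ST); last first.
  by move=> m _ /negPf ->; rewrite scale0r.
by apply: eq_big_seq => m ->.
Qed.

Lemma cf_sum a : a = \sum_(m <- dom a) cf a m *: e m.
Proof.
rewrite [LHS](projT2 (cid (projT2 (cid (e_span a))))).
by apply: eq_big_seq => m; rewrite /cf => ->.
Qed.

Lemma cf_outside a m : m \notin dom a -> cf a m = 0.
Proof. by rewrite /cf => /negPf ->. Qed.

Lemma cfE a (S : {fset Gam}) (f : Gam -> C) :
  a = \sum_(m <- S) f m *: e m -> forall m, cf a m = if m \in S then f m else 0.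
Proof.
move=> aE m; pose T := (dom a `|` S)%fset.
have aE1 : a = \sum_(k <- T) cf a k *: e k.
  rewrite [LHS]cf_sum (sum_fset_widen _ (fsubsetUl _ S)).
  by apply: eq_bigr => k _; case: ifPn => // /cf_outside ->.
have aE2 : a = \sum_(k <- T) (if k \in S then f k else 0) *: e k.
  by rewrite [LHS]aE (sum_fset_widen _ (fsubsetUr (dom a) S)).
case: (boolP (m \in T)) => [mT|]; last first.
  by rewrite in_fsetU negb_or => /andP[/cf_outside -> /negPf ->].
apply/eqP; rewrite -subr_eq0; apply/eqP.
apply: (@monomials_free T
  (fun k => cf a k - if k \in S then f k else 0)) mT; first exact: fset_uniq.
under eq_bigr do rewrite scalerBl.
by rewrite sumrB -aE1 -aE2 subrr.
Qed.

Lemma cf_lin c a b m : cf (c *: a + b) m = c * cf a m + cf b m.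
Proof.
pose T := (dom a `|` dom b)%fset.
have -> := @cfE (c *: a + b) T (fun k => c * cf a k + cf b k); last first.
  under eq_bigr do rewrite scalerDl -scalerA.
  rewrite big_split /= -scaler_sumr.
  rewrite [in LHS](cf_sum a) [in LHS](cf_sum b).
  rewrite (sum_fset_widen _ (fsubsetUl _ (dom b))).
  rewrite [X in _ + X = _](sum_fset_widen _ (fsubsetUr (dom a) _)).
  by congr (_ *: _ + _); apply: eq_bigr => k _; case: ifPn => // /cf_outside ->.
case: ifPn => //; rewrite in_fsetU negb_or => /andP[/cf_outside -> /cf_outside ->].
by rewrite mulr0 addr0.
Qed.

Lemma cf0 m : cf 0 m = 0.
Proof.
by have := cf_lin (- 1) 0 0 m; rewrite scaler0 addr0 mulN1r addNr.
Qed.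

Lemma cfZ c a m : cf (c *: a) m = c * cf a m.
Proof. by have := cf_lin c a 0 m; rewrite cf0 !addr0. Qed.

Lemma cfD a b m : cf (a + b) m = cf a m + cf b m.
Proof. by have := cf_lin 1 a b m; rewrite scale1r mul1r. Qed.

Lemma cf_bigsum (I : Type) (r : seq I) (P : pred I) (F : I -> A) m :
  cf (\sum_(i <- r | P i) F i) m = \sum_(i <- r | P i) cf (F i) m.
Proof.
by elim/big_rec2: _ => [|i y1 y2 _ <-]; [exact: cf0 | exact: cfD].
Qed.

Lemma cf_e k m : cf (e k) m = (m == k)%:R.
Proof.
rewrite (@cfE (e k) [fset k]%fset (fun _ => 1)) ?big_seq_fset1 ?scale1r //.
by rewrite in_fset1; case: eqP.
Qed.

Lemma cf_eq0 a : (forall m, cf a m = 0) -> a = 0.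
Proof.
by move=> a0; rewrite (cf_sum a) big1 // => m _; rewrite a0 scale0r.
Qed.

Lemma cf_neq0 a : a != 0 -> exists m, cf a m != 0.
Proof.
move=> a0; apply: contrapT => H; move/eqP: a0; apply; apply: cf_eq0 => m.
by apply/eqP; apply: contraT => cfm; case: H; exists m.
Qed.

Lemma mem_dom a m : cf a m != 0 -> m \in dom a.
Proof. by apply: contraR => /cf_outside ->. Qed.

Let sc (m k : Gam) : C := q ^ projT1 (cid (eM m k)).

Lemma e_mul m k : e m * e k = sc m k *: e (m + k).
Proof. exact: projT2 (cid (eM m k)). Qed.

Lemma sc_neq0 m k : sc m k != 0.
Proof. by rewrite expfz_neq0. Qed.

Lemma cf_eMl k b m : cf (e k * b) m = sc k (m - k) * cf b (m - k).
Proof.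
rewrite {1}(cf_sum b) mulr_sumr cf_bigsum.
have E j : cf (e k * (cf b j *: e j)) m =
    if j == m - k then sc k (m - k) * cf b (m - k) else 0.
  rewrite -scalerAr e_mul !cfZ cf_e -(inj_eq (addIr (- k))) [k + j]addrC addrK.
  by rewrite eq_sym; case: eqP => [->|_]; rewrite ?mulr0 ?mulr1 // mulrC.
under eq_bigr do rewrite E.
case: (boolP (m - k \in dom b)) => [mk|/cf_outside bmk].
  rewrite (bigD1_seq (m - k) mk (fset_uniq _)) /= eqxx big1 ?addr0 //.
  by move=> j /negPf ->.
by rewrite big1 => [|j _]; rewrite bmk mulr0 //; case: ifP.
Qed.

Lemma cf_eMl_neq0 k b m : cf (e k * b) m != 0 -> cf b (m - k) != 0.
Proof. by apply: contraNneq => bmk; rewrite cf_eMl bmk mulr0. Qed.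

Lemma cfM a b m :
  cf (a * b) m = \sum_(k <- dom a) cf a k * (sc k (m - k) * cf b (m - k)).
Proof.
rewrite {1}(cf_sum a) mulr_suml cf_bigsum; apply: eq_bigr => k _.
by rewrite -scalerAl cfZ cf_eMl.
Qed.

(* No [d] is a degree of [0]. *)
Definition has_deg (lam : Gam -> int) (a : A) (d : int) : Prop :=
  (forall m, cf a m != 0 -> lam m <= d) /\ exists m, cf a m != 0 /\ lam m = d.

Lemma has_deg_exists lam a : a != 0 -> exists d, has_deg lam a d.
Proof.
move=> /cf_neq0[m0 am0].
have [m [am mmax]] : exists m, cf a m != 0 /\
    forall k, k \in (dom a : seq Gam) -> cf a k != 0 -> lam k <= lam m.
  elim: (dom a : seq Gam) => [|k s [m [am IH]]]; first by exists m0.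
  case: (boolP ((cf a k != 0) && (lam m < lam k))) => [/andP[ak mk]|H].
    exists k; split=> // j; rewrite inE => /predU1P[-> //|js aj].
    exact: le_trans (IH j js aj) (ltW mk).
  exists m; split=> // j; rewrite inE => /predU1P[->|js] aj; last exact: IH.
  by move: H; rewrite aj /= -leNgt.
exists (lam m); split; last by exists m.
by move=> k ak; apply: mmax => //; apply: mem_dom.
Qed.

Lemma has_deg_uniq lam a d d' : has_deg lam a d -> has_deg lam a d' -> d = d'.
Proof.
move=> [H [m [am md]]] [H' [m' [am' md']]].
by apply: le_anti; rewrite -{1}md -{2}md' H' // H.
Qed.

(** * Leading forms and the absence of zero divisors *)

Section Degree.
Variable lam : Gam -> int.
Hypothesis lamD : {morph lam : m k / m + k}.

Definition lead (a : A) (d : int) : A :=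
  \sum_(m <- dom a) (if lam m == d then cf a m else 0) *: e m.

Lemma cf_lead a d m : cf (lead a d) m = if lam m == d then cf a m else 0.
Proof.
rewrite (cfE (erefl (lead a d))); case: ifPn => // /cf_outside ->.
by rewrite if_same.
Qed.

Lemma cfM_wide (S : {fset Gam}) a b m : (dom a `<=` S)%fset ->
  cf (a * b) m = \sum_(k <- S) cf a k * (sc k (m - k) * cf b (m - k)).
Proof.
move=> aS; rewrite cfM; apply: (big_fset_incl _ aS) => k _ /cf_outside ->.
by rewrite mul0r.
Qed.

(** Both degrees are maximal, so a contribution to the product in degree [d + d'] comes from terms
    of degrees exactly [d] and [d']. *)
Lemma cfM_lead a b d d' m : has_deg lam a d -> has_deg lam b d' ->
  lam m = d + d' -> cf (lead a d * lead b d') m = cf (a * b) m.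
Proof.
move=> [ad _] [bd _] lm.
rewrite (cfM_wide _ _ (fsubsetUl (dom (lead a d)) (dom a))).
rewrite (cfM_wide _ _ (fsubsetUr (dom (lead a d)) (dom a))).
apply: eq_bigr => k _; rewrite !cf_lead.
have lE : lam (m - k) = lam m - lam k.
  by apply/eqP; rewrite eq_sym subr_eq -lamD subrK.
have [-> |ak] := eqVneq (cf a k) 0; first by rewrite if_same !mul0r.
have [-> |bk] := eqVneq (cf b (m - k)) 0; first by rewrite if_same !mulr0.
have := ad _ ak; have := bd _ bk; rewrite lE lm => h1 h2.
by have -> : lam k = d; [lia | rewrite addrAC subrr add0r !eqxx].
Qed.

Lemma lead_neq0 a d : has_deg lam a d -> lead a d != 0.
Proof.
move=> [_ [m [am lm]]]; apply: contraNneq am => l0.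
by have := cf_lead a d m; rewrite l0 cf0 lm eqxx => <-.
Qed.

(** The leading forms are assumed to have nonzero product because this lemma itself serves to prove
    that [A] is a domain; [has_degM] then removes the assumption. *)
Lemma has_degM_lead a b d d' : has_deg lam a d -> has_deg lam b d' ->
  lead a d * lead b d' != 0 -> has_deg lam (a * b) (d + d').
Proof.
move=> ad bd /cf_neq0[m lm].
have lmE : lam m = d + d'.
  apply: contraNeq lm => lm; rewrite cfM big1 // => k _; rewrite !cf_lead.
  have lE : lam (m - k) = lam m - lam k.
    by apply/eqP; rewrite eq_sym subr_eq -lamD subrK.
  rewrite lE; case: eqP => [->|_]; last by rewrite mul0r.
  case: eqP => [H|_]; last by rewrite !mulr0.
  by move: lm; rewrite -(subrK d (lam m)) H addrC eqxx.
split; last by exists m; rewrite -(cfM_lead ad bd).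
move=> k abk; rewrite leNgt; apply: contra abk => lk.
rewrite cfM big1 // => j _.
have [-> |aj] := eqVneq (cf a j) 0; first by rewrite mul0r.
have [-> |bj] := eqVneq (cf b (k - j)) 0; first by rewrite !mulr0.
have lE : lam (k - j) = lam k - lam j.
  by apply/eqP; rewrite eq_sym subr_eq -lamD subrK.
by have := ad.1 _ aj; have := bd.1 _ bj; rewrite lE; lia.
Qed.

End Degree.

Lemma coord_morph (i : 'I_N) : {morph (fun m : Gam => m i) : m k / m + k}.
Proof. by move=> m k; rewrite ffunE. Qed.

(* Taking leading forms along the coordinates one after the other reduces
   the claim to a product of two monomials. *)
Lemma mul_neq0_coords (s : seq 'I_N) : forall a b : A, a != 0 -> b != 0 ->
  (forall i, i \notin s -> forall m m', cf a m != 0 -> cf a m' != 0 -> m i = m' i) ->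
  (forall i, i \notin s -> forall m m', cf b m != 0 -> cf b m' != 0 -> m i = m' i) ->
  a * b != 0.
Proof.
elim: s => [|i s IH] a b a0 b0 sa sb.
  (* With every coordinate constant on the support, the support is a single point. *)
  have mono c : c != 0 -> (forall i, i \notin [::] -> forall m m',
      cf c m != 0 -> cf c m' != 0 -> m i = m' i) ->
      exists k z, z != 0 /\ c = z *: e k.
    move=> /cf_neq0[k ck] H; exists k, (cf c k); split=> //.
    apply/eqP; rewrite -subr_eq0; apply/eqP; apply: cf_eq0 => m.
    rewrite -scaleN1r addrC cf_lin cfZ cf_e mulN1r.
    case: eqP => [->|mk]; first by rewrite mulr1 addNr.
    rewrite mulr0 oppr0 add0r; apply/eqP; apply: contraT => cm.
    by case: mk; apply/ffunP => i; apply: H.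
  have [k [z [z0 ->]]] := mono a a0 sa; have [l [w [w0 ->]]] := mono b b0 sb.
  rewrite -scalerAl -scalerAr e_mul !scaler_eq0 !negb_or z0 w0 sc_neq0.
  exact: e_neq0.
have [d ad] := has_deg_exists (fun m => m i) a0.
have [d' bd] := has_deg_exists (fun m => m i) b0.
have := has_degM_lead (coord_morph i) ad bd.
case; last by move=> _ [m [abm _]]; apply: contraNneq abm => ->; rewrite cf0.
(* Passing to the leading form along [i] shrinks the support: coordinate [i] becomes constant and
   constant coordinates stay so. *)
have const c (cd : int) (sc' : forall j, j \notin i :: s -> forall m m',
    cf c m != 0 -> cf c m' != 0 -> m j = m' j) j : j \notin s ->
    forall m m', cf (lead (fun m => m i) c cd) m != 0 ->
    cf (lead (fun m => m i) c cd) m' != 0 -> m j = m' j.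
  move=> js m m'; rewrite !cf_lead.
  have [mi|_] := eqVneq (m i) cd; last by rewrite eqxx.
  have [mi' cm cm'|_] := eqVneq (m' i) cd; last by rewrite eqxx.
  have [->|ji] := eqVneq j i; first by rewrite mi mi'.
  by apply: sc' => //; rewrite inE negb_or ji.
apply: IH; [exact: lead_neq0 ad | exact: lead_neq0 bd | |]; exact: const.
Qed.

Lemma quantum_torus_domain (a b : A) : a != 0 -> b != 0 -> a * b != 0.
Proof.
by move=> a0 b0; apply: (@mul_neq0_coords (enum 'I_N)) => // i; rewrite mem_enum.
Qed.

Lemma has_degM lam a b d d' : {morph lam : m k / m + k} ->
  has_deg lam a d -> has_deg lam b d' -> has_deg lam (a * b) (d + d').
Proof.
move=> lamD ad bd; apply: has_degM_lead => //.
by apply: quantum_torus_domain; [exact: lead_neq0 ad | exact: lead_neq0 bd].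
Qed.

Lemma has_deg_e lam k : has_deg lam (e k) (lam k).
Proof.
split=> [m|]; last by exists k; rewrite cf_e eqxx oner_eq0.
by rewrite cf_e; case: (eqVneq m k) => [-> //|_]; rewrite mulr0n eqxx.
Qed.

(** * The Ore condition *)

Lemma bounded_support (a : A) : exists B : nat,
  forall m, cf a m != 0 -> forall i, (`|m i| <= B)%N.
Proof.
have [->|a0] := eqVneq a 0.
  by exists 0%N => m; rewrite cf0 eqxx.
(* Degrees exist for any function of the exponents, here the l1 norm, which is not additive. *)
have [d [dP _]] :=
  has_deg_exists
    (fun m : Gam => \sum_i `|m i|%:Z) a0.
exists `|d|%N => m am i; have := dP m am.
rewrite (bigD1 i) //= => H.
have : 0 <= \sum_(j < N | j != i) `|m j|%:Z by apply: sumr_ge0.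
by move: H; set x := \sum_(j < N | _) _; lia.
Qed.

(* Left multiplication by combinations of the [L^N] monomials of a large
   cube maps [A^2] into a space of dimension less than [2 * L^N]. *)
Lemma quantum_torus_ore (a b : A) : a != 0 -> b != 0 ->
  exists c d, c * a = d * b /\ c * a != 0.
Proof.
move=> a0 b0; have [Ba aB] := bounded_support a; have [Bb bB] := bounded_support b.
pose B := maxn Ba Bb.
have [L [L0 ltL]] := expn_add_lt_double (2 * B) N.
(* [U] indexes the monomials of the cube [[0, L)^N]. Their products with [a] and [b] are supported
   in [[-B, L + B)^N], which [T] enumerates shifted by [B]. *)
pose T := {ffun 'I_N -> 'I_(L + 2 * B)}; pose U := {ffun 'I_N -> 'I_L}.
pose io (f : U) : Gam := [ffun i => (f i : nat)%:Z].
pose it (f : T) : Gam := [ffun i => (f i : nat)%:Z - B%:Z].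
pose ab (x : bool) := if x then a else - b.
have abB x m : cf (ab x) m != 0 -> forall i, (`|m i| <= B)%N.
  case: x => /= H i; first exact: leq_trans (aB m H i) (leq_maxl _ _).
  apply: leq_trans (bB m _ i) (leq_maxr _ _).
  by move: H; rewrite -scaleN1r cfZ mulN1r oppr_eq0.
pose G (u : bool * U) (t : T) := cf (e (io u.2) * ab u.1) (it t).
have [|w [[[x0 u0] w0] wP]] := @linear_dependency _ _ _ G.
  by rewrite card_prod card_bool !card_ffun !card_ord.
pose cc x := \sum_(f : U) w (x, f) *: e (io f).
have io_inj : injective io.
  move=> f g /ffunP H; apply/ffunP => i.
  by have := H i; rewrite !ffunE => -[] /val_inj.
have cf_cc x f : cf (cc x) (io f) = w (x, f).
  rewrite cf_bigsum (bigD1 f) //= big1 => [|g gf].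
    by rewrite cfZ cf_e eqxx mulr1 addr0.
  rewrite cfZ cf_e.
  by rewrite (inj_eq io_inj) eq_sym (negPf gf) mulr0.
have sum0 : cc true * a + cc false * (- b) = 0.
  transitivity (\sum_(x : bool) cc x * ab x).
    by rewrite big_bool.
  have -> : \sum_(x : bool) cc x * ab x =
      \sum_(u : bool * U) w u *: (e (io u.2) * ab u.1).
    transitivity (\sum_(x : bool) \sum_(f : U) w (x, f) *: (e (io f) * ab x));
      last by rewrite pair_bigA; apply: eq_bigr => -[].
    apply: eq_bigr => x _; rewrite mulr_suml.
    by apply: eq_bigr => f _; rewrite scalerAl.
  apply: cf_eq0 => m.
  rewrite cf_bigsum.
  under eq_bigr do rewrite cfZ.
  case: (pselect (exists t, it t = m)) => [[t <-]|mt]; first exact: wP.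
  apply: big1 => -[x f] _ /=; apply/eqP; apply: contraT.
  rewrite mulf_eq0 negb_or => /andP[_ /cf_eMl_neq0/abB H].
  case: mt.
  have lt i : (`|(m i + B%:Z)%R| < L + 2 * B)%N.
    have := H i; rewrite !ffunE; have := ltn_ord (f i).
    move: (m i) (nat_of_ord (f i)) => z k; lia.
  exists [ffun i => Ordinal (lt i)]; apply/ffunP => i; rewrite !ffunE /=.
  have := H i; rewrite !ffunE; have := ltn_ord (f i).
  move: (m i) (nat_of_ord (f i)) => z k; lia.
have caE : cc true * a = cc false * b.
  by apply/eqP; rewrite -subr_eq0 -mulrN sum0.
exists (cc true), (cc false); split=> //.
(* The nonzero weight is a coefficient of [cc x0], so one of the two equal products is nonzero, [A]
   being a domain. *)
have ccx0 : cc x0 != 0.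
  by apply: contraNneq w0 => cc0; rewrite -cf_cc cc0 cf0.
by case: x0 w0 ccx0 => w0 cc0; [| rewrite caE]; apply: quantum_torus_domain.
Qed.

End Monomials.

(** * Commuting operators *)

Section FiniteDim.
Variables (C : fieldType) (M : lmodType C) (V : M -> Prop).
Variables (D : finType) (kap : M -> D -> C).
Hypothesis V_lin : forall c u v, V u -> V v -> V (c *: u + v).
Hypothesis kap_lin : forall c u v d, kap (c *: u + v) d = c * kap u d + kap v d.
Hypothesis kap_inj : forall v, V v -> (forall d, kap v d = 0) -> v = 0.

Let lc r (b : 'I_r -> M) (w : 'rV[C]_r) : M := \sum_i w 0 i *: b i.

(** A free family of maximal size is a basis; sizes are bounded since the finitely many coordinates
    [kap] separate the points of [V]. *)
Lemma finite_dim_basis v0 : V v0 -> v0 != 0 ->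
  exists r (b : 'I_r.+1 -> M), [/\ forall w, V (lc b w),
    forall w, lc b w = 0 -> w = 0 & forall v, V v -> exists w, v = lc b w].
Proof.
move=> V0 v00.
have Vz : V 0 by have := V_lin (- 1) V0 V0; rewrite scaleN1r addNr.
have kapZ c v d : kap (c *: v) d = c * kap v d.
  have k0 : kap 0 d = 0.
    by have := kap_lin (- 1) 0 0 d; rewrite scaler0 addr0 mulN1r addNr.
  by have := kap_lin c v 0 d; rewrite k0 !addr0.
have kap_sum (I : finType) (F : I -> M) d : kap (\sum_i F i) d = \sum_i kap (F i) d.
  elim/big_rec2: _ => [|i y1 y2 _ <-].
    by have := kapZ 0 0 d; rewrite scale0r mul0r.
  by have := kap_lin 1 (F i) y2 d; rewrite scale1r mul1r.
have V_sum r (b : 'I_r -> M) w : (forall i, V (b i)) -> V (lc b w).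
  move=> Vb; rewrite /lc; elim/big_ind: _ => //.
    by move=> u v Vu Vv; rewrite -[u]scale1r; apply: V_lin.
  by move=> i _; rewrite -[_ *: _]addr0; apply: V_lin.
(* [P r] concerns families of [r.+1] vectors: [v0] alone gives [P 0], and the basis is never
   empty. *)
pose P r := `[< exists b : 'I_r.+1 -> M, (forall i, V (b i)) /\
                forall w, lc b w = 0 -> w = 0 >].
have exP : exists r, P r.
  exists 0%N; apply/asboolP; exists (fun _ => v0); split=> // w.
  rewrite /lc big_ord1 => /eqP; rewrite scaler_eq0 (negPf v00) orbF => /eqP w0.
  by apply/rowP => i; rewrite ord1 w0 mxE.
have boundP r : P r -> (r <= #|D|)%N.
  move=> /asboolP[b [Vb b_free]]; rewrite leqNgt; apply/negP => ltD.
  have [|w [[i wi] wP]] := @linear_dependency C 'I_r.+1 D (fun i d => kap (b i) d).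
    by rewrite card_ord; apply: leqW.
  have w0 : lc b (\row_i w i) = 0.
    apply: kap_inj => [|d]; first exact: V_sum.
    rewrite kap_sum -[RHS](wP d); apply: eq_bigr => j _.
    by rewrite kapZ mxE.
  by move: wi => /eqP; apply; have /rowP/(_ i) := b_free _ w0; rewrite !mxE.
have [r /asboolP[b [Vb b_free]] maxr] := ex_maxnP exP boundP.
exists r, b; split=> // [w|v Vv]; first exact: V_sum.
pose b' (i : 'I_r.+2) := if unlift ord0 i is Some j then b j else v.
have : ~ P r.+1 by move=> /maxr; rewrite ltnn.
have Vb' i : V (b' i) by rewrite /b'; case: unliftP.
move=> nP; have [w [w0 wn0]] : exists w, lc b' w = 0 /\ w <> 0.
  apply: contrapT => H; apply: nP; apply/asboolP; exists b'; split=> // w w0.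
  by apply: contrapT => wn0; apply: H; exists w.
have lcE : lc b' w = w 0 ord0 *: v + lc b (\row_i w 0 (lift ord0 i)).
  rewrite /lc big_ord_recl /b' unlift_none; congr (_ + _).
  by apply: eq_bigr => i _; rewrite liftK mxE.
rewrite w0 in lcE.
(* A relation not involving [v] would contradict the freeness of [b]; otherwise it can be solved for
   [v]. *)
have [w00|w00] := eqVneq (w 0 ord0) 0.
  rewrite w00 scale0r add0r in lcE; case: wn0.
  have /rowP H := b_free _ (esym lcE); apply/rowP => i; rewrite [RHS]mxE.
  case: (unliftP ord0 i) => [j ->|-> //].
  by have := H j; rewrite !mxE.
exists (- (w 0 ord0)^-1 *: \row_i w 0 (lift ord0 i)).
have -> : lc b (- (w 0 ord0)^-1 *: \row_i w 0 (lift ord0 i)) =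
    - (w 0 ord0)^-1 *: lc b (\row_i w 0 (lift ord0 i)).
  by rewrite /lc scaler_sumr; apply: eq_bigr => i _; rewrite scalerA !mxE.
apply: (scalerI w00); rewrite scalerA mulrN divff // scaleN1r.
by apply/eqP; rewrite -addr_eq0 -lcE.
Qed.

End FiniteDim.

(* Taking determinants in [T j T k = q^l T k T j] on a space of dimension [r]
   gives [q^(l r) = 1], hence [l = 0]: the operators commute. *)
Lemma common_eigenvector_qcomm (C : numClosedFieldType) (q : C)
    (M : lmodType C) (V : M -> Prop) (D : finType) (kap : M -> D -> C)
    (N : nat) (T : 'I_N -> M -> M) v0 :
  q != 0 -> (forall k : nat, (0 < k)%N -> q ^+ k != 1) ->
  (forall c u v, V u -> V v -> V (c *: u + v)) ->
  (forall c u v d, kap (c *: u + v) d = c * kap u d + kap v d) ->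
  (forall v, V v -> (forall d, kap v d = 0) -> v = 0) ->
  V v0 -> v0 != 0 ->
  (forall j c u v, T j (c *: u + v) = c *: T j u + T j v) ->
  (forall j v, V v -> V (T j v)) ->
  (forall j v, T j v = 0 -> v = 0) ->
  (forall j k, exists l : int, forall v, T j (T k v) = q ^ l *: T k (T j v)) ->
  exists v, [/\ V v, v != 0 & forall j, exists c, T j v = c *: v].
Proof.
move=> q0 q_nroot V_lin kap_lin kap_inj V0 v00 T_lin TV T_inj T_comm.
have [r [b [Vb b_free b_span]]] :=
  finite_dim_basis V_lin kap_lin kap_inj V0 v00.
set lc := fun w : 'rV_r.+1 => \sum_i w 0 i *: b i in Vb b_free b_span.
have {}b_free w : lc w = 0 -> w = 0 by apply: b_free.
have lc_lin c u v : lc (c *: u + v) = c *: lc u + lc v.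
  rewrite /lc scaler_sumr -big_split; apply: eq_bigr => i _ /=.
  by rewrite !mxE scalerDl scalerA.
have lc_inj : injective lc.
  move=> u v uv; apply/eqP; rewrite -subr_eq0; apply/eqP; apply: b_free.
  by rewrite (linear_mapB lc_lin) uv subrr.
have row_lc i : lc (delta_mx 0 i) = b i.
  rewrite /lc (bigD1 i) //= mxE !eqxx scale1r big1 ?addr0 // => j ji.
  by rewrite mxE eqxx (negPf ji) scale0r.
have /choice[rw rwE] : forall ji : 'I_N * 'I_r.+1, exists w, T ji.1 (b ji.2) = lc w.
  by move=> [j i]; apply: b_span; apply: TV; rewrite -row_lc; apply: Vb.
pose X j : 'M[C]_r.+1 := \matrix_i rw (j, i).
have T_sum j (F : 'I_r.+1 -> M) : T j (\sum_i F i) = \sum_i T j (F i).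
  elim/big_rec2: _ => [|i y1 y2 _ <-]; first exact: linear_map0 (T_lin j).
  exact: linear_mapD (T_lin j) _ _.
have lc_sum (F : 'I_r.+1 -> 'rV_r.+1) : lc (\sum_i F i) = \sum_i lc (F i).
  elim/big_rec2: _ => [|i y1 y2 _ <-]; first exact: linear_map0 lc_lin.
  exact: linear_mapD lc_lin _ _.
have T_lc j w : T j (lc w) = lc (w *m X j).
  rewrite mulmx_sum_row lc_sum {1}/lc T_sum; apply: eq_bigr => i _.
  by rewrite (linear_mapZ (T_lin j)) (linear_mapZ lc_lin) (rwE (j, i)) rowK.
have X_unit j : X j \in unitmx.
  rewrite -row_free_unit -kermx_eq0; apply/eqP/row_matrixP => i; rewrite row0.
  apply: b_free; apply: (T_inj j); rewrite T_lc -row_mul mulmx_ker row0.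
  by rewrite (linear_map0 lc_lin).
have X_comm j k : X j *m X k = X k *m X j.
  (* Matrices act on row vectors from the right, which reverses composition; hence the swapped
     indices. *)
  have [l lE] := T_comm k j.
  have XE : X j *m X k = q ^ l *: (X k *m X j).
    apply/row_matrixP => i; rewrite !rowE; apply: lc_inj.
    rewrite mulmxA -!T_lc lE !T_lc -(linear_mapZ lc_lin).
    by rewrite -mulmxA scalemxAr.
  have := congr1 (fun Z => \det Z) XE; rewrite detZ !det_mulmx.
  rewrite [\det (X k) * _]mulrC -[LHS]mul1r => /mulIf H.
  have /esym : 1 = (q ^ l) ^+ r.+1.
    by apply: H; rewrite mulf_neq0 // -unitfE -unitmxE.
  rewrite exprnP exprz_exp => /(expz_q_eq1 q_nroot)/eqP.
  by rewrite mulf_eq0 orbF XE => /eqP ->; rewrite expr0z scale1r.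
have [|w w0 /allP wX] :=
    @common_eigenvector C _ [seq X j | j <- enum 'I_N] (ltn0Sn r).
  by move=> _ _ /mapP[j _ ->] /mapP[k _ ->]; apply: X_comm.
exists (lc w); split=> [||j]; first exact: Vb.
  by apply: contra w0 => /eqP/b_free ->.
have /wX/sub_rVP[c cE] : X j \in [seq X j | j <- enum 'I_N].
  by apply: map_f; rewrite mem_enum.
by exists c; rewrite T_lc cE (linear_mapZ lc_lin).
Qed.

(** * Monomials of a quantum torus *)

Section Subalgebra.
Variables (C : fieldType) (A : algType C) (P : A -> Prop).
Hypothesis P1 : P 1.
Hypothesis P_lin : forall c u v, P u -> P v -> P (c *: u + v).
Hypothesis PM : forall u v, P u -> P v -> P (u * v).

(** The closed predicate is turned into an algebra in its own right, because the universal property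
    of the presentation speaks of maps between algebras. *)
Definition subalg_pred : {pred A} := fun a => `[< P a >].

Fact subalg_pred_closed : subalg_closed subalg_pred.
Proof.
split; first exact/asboolP.
- by move=> c u v /asboolP Pu /asboolP Pv; apply/asboolP/P_lin.
- by move=> u v /asboolP Pu /asboolP Pv; apply/asboolP/PM.
Qed.

HB.instance Definition _ :=
  GRing.isSubalgClosed.Build C A subalg_pred subalg_pred_closed.

Record subalg := Subalg { subalg_val : A; _ : subalg_val \in subalg_pred }.
HB.instance Definition _ := [isSub for subalg_val].
HB.instance Definition _ := [Choice of subalg by <:].
HB.instance Definition _ := [SubChoice_isSubAlgebra of subalg by <:].

Definition in_subalg a (Pa : P a) : subalg := Subalg (asboolT Pa).

(* The universal map into the subalgebra, followed by the inclusion, agrees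
   with the identity on the generators. *)
Lemma quantum_torus_ind (n : nat) (q : C) (x xi y yi : 'I_n -> A) :
  is_quantum_torus q x xi y yi ->
  (forall i, P (x i)) -> (forall i, P (xi i)) ->
  (forall i, P (y i)) -> (forall i, P (yi i)) -> forall a, P a.
Proof.
move=> [[r1 r2 r3 r4 r5] univ] Px Pxi Py Pyi a.
pose X i : subalg := in_subalg (Px i); pose Xi i : subalg := in_subalg (Pxi i).
pose Y i : subalg := in_subalg (Py i); pose Yi i : subalg := in_subalg (Pyi i).
have rel : qt_rel q X Xi Y Yi.
  split.
  - by move=> i; split; apply: val_inj; have [] := r1 i.
  - by move=> i; split; apply: val_inj; have [] := r2 i.
  - by move=> i; apply: val_inj; apply: r3.
  - by move=> i j ij; have [h1 h2 h3] := r4 i j ij; split; apply: val_inj.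
  - move=> i j ij; have [h1 [h2 [h3 [h4 [h5 [h6 h7]]]]]] := r5 i j ij.
    by do !split; apply: val_inj.
have [[f [[f_lin fM f1] fE]] _] := univ subalg X Xi Y Yi rel.
have hom_vf : alg_hom (fun a => subalg_val (f a)).
  split=> [c u v|u v|].
  - by rewrite f_lin.
  - by rewrite fM.
  - by rewrite f1.
have hom_id : alg_hom (id : A -> A) by [].
have [_ uniq_hom] := univ A x xi y yi (And5 r1 r2 r3 r4 r5).
have <- : subalg_val (f a) = a.
  by apply: (uniq_hom _ _ hom_vf hom_id) => i; have [-> -> -> ->] := fE i.
by case: (f a) => b /= /asboolP.
Qed.

End Subalgebra.

(** * Powers and ordered products of units that commute up to powers of q *)

Section QCommute.
Variables (C : fieldType) (A : algType C) (q : C).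
Hypothesis q_neq0 : q != 0.

Definition qcomm (k : int) (u v : A) : Prop := u * v = q ^ k *: (v * u).

Lemma qcomm1l v : qcomm 0 1 v.
Proof. by rewrite /qcomm expr0z scale1r mul1r mulr1. Qed.

Lemma qcommC k u v : qcomm k u v -> qcomm (- k) v u.
Proof.
by move=> uv; rewrite /qcomm uv scalerA -expfzDr // addNr expr0z scale1r.
Qed.

Lemma qcommMr k l u v w : qcomm k u v -> qcomm l u w -> qcomm (k + l) u (v * w).
Proof.
rewrite /qcomm => uv uw.
by rewrite mulrA uv -scalerAl -(mulrA v u) uw -scalerAr scalerA mulrA expfzDr.
Qed.

Lemma qcommMl k l u v w : qcomm k u w -> qcomm l v w -> qcomm (k + l) (u * v) w.
Proof.
move=> /qcommC uw /qcommC vw; rewrite -[k + l]opprK opprD.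
exact/qcommC/qcommMr.
Qed.

Lemma qcommV k u ui v : u * ui = 1 -> ui * u = 1 -> qcomm k u v -> qcomm (- k) ui v.
Proof.
rewrite /qcomm => uui uiu uv.
have -> : ui * v = ui * (q ^ (- k) *: (u * v)) * ui.
  by rewrite uv scalerA -expfzDr // addNr expr0z scale1r mulrA -mulrA uui mulr1.
by rewrite -scalerAr -scalerAl mulrA uiu mul1r.
Qed.

Lemma qcommXl k u v n : qcomm k u v -> qcomm (k * n%:Z) (u ^+ n) v.
Proof.
move=> uv; elim: n => [|n IH]; first by rewrite mulr0; apply: qcomm1l.
by rewrite exprS intS mulrDr mulr1; apply: qcommMl.
Qed.

(** The inverse is passed as data, in line with the presentation, where inverses are among the
    generators. *)
Definition upow (u ui : A) (k : int) : A :=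
  match k with Posz n => u ^+ n | Negz n => ui ^+ n.+1 end.

Lemma qcomm_upow k u ui v l :
  u * ui = 1 -> ui * u = 1 -> qcomm k u v -> qcomm (k * l) (upow u ui l) v.
Proof.
move=> uui uiu uv; case: l => n /=; first exact: qcommXl.
by rewrite NegzE mulrN -mulNr; apply/qcommXl/(qcommV uui uiu).
Qed.

Lemma upowD u ui k l : u * ui = 1 -> ui * u = 1 ->
  upow u ui (k + l) = upow u ui k * upow u ui l.
Proof.
move=> uui uiu.
have S j : upow u ui (j + 1) = upow u ui j * u.
  case: j => [n|[|n]].
  - by rewrite -PoszD addn1 /= exprSr.
  - by rewrite (_ : Negz 0 + 1 = 0) //= expr1 uiu.
  - rewrite (_ : Negz n.+1 + 1 = Negz n); last by lia.
    by rewrite /= [ui ^+ n.+2]exprSr -mulrA uiu mulr1.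
have P j : upow u ui (j - 1) = upow u ui j * ui.
  by rewrite -[in RHS](subrK 1 j) S -mulrA uui mulr1.
elim/int_rect: l => [|n IH|n IH]; first by rewrite addr0 mulr1.
- by rewrite -addn1 PoszD addrA !S IH mulrA.
- by rewrite -addn1 PoszD opprD addrA !P IH mulrA.
Qed.

Section Frame.
Variables (N : nat) (z zi : 'I_N -> A) (Om : 'I_N -> 'I_N -> int).
Local Notation Gam := {ffun 'I_N -> int}.
Hypothesis z_unit : forall i, z i * zi i = 1 /\ zi i * z i = 1.
Hypothesis z_comm : forall i j, qcomm (Om i j) (z i) (z j).

(** The list of indices is a parameter to allow induction on it. *)
Definition monomial_on (s : seq 'I_N) (m : Gam) : A :=
  \prod_(i <- s) upow (z i) (zi i) (m i).
Definition monomial := monomial_on (enum 'I_N).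

Lemma qcomm_monomial_on s (m : Gam) u (om : 'I_N -> int) :
  (forall i, qcomm (om i) (z i) u) ->
  qcomm (\sum_(i <- s) om i * m i) (monomial_on s m) u.
Proof.
move=> zu; rewrite /monomial_on; elim: s => [|i s IH].
  by rewrite !big_nil; apply: qcomm1l.
by rewrite !big_cons; apply: qcommMl => //; apply: qcomm_upow; case: (z_unit i).
Qed.

(** By induction on the indices: the leading power of the second monomial is moved past the tail of
    the first at the cost of a power of [q]. *)
Lemma monomialM (m k : Gam) : qsim q (monomial m * monomial k) (monomial (m + k)).
Proof.
rewrite /monomial; elim: (enum 'I_N) => [|i s [l IH]].
  by exists 0; rewrite /monomial_on !big_nil mulr1 scale1r.
have [j jE] : exists j, qcomm j (monomial_on s m) (upow (z i) (zi i) (k i)).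
  eexists; apply: qcomm_monomial_on => t.
  have [zzi ziz] := z_unit i.
  by apply: qcommC; apply: qcomm_upow; last exact: z_comm.
exists (j + l); rewrite /monomial_on !big_cons -!/(monomial_on s _).
rewrite -mulrA [monomial_on s m * _]mulrA jE -scalerAl -scalerAr.
rewrite -[_ * _ * monomial_on s k]mulrA.
rewrite IH -!scalerAr scalerA expfzDr // ffunE mulrA.
by rewrite upowD //; case: (z_unit i).
Qed.

Lemma monomial_single j k :
  monomial [ffun i => if i == j then k else 0] = upow (z j) (zi j) k.
Proof.
rewrite /monomial.
have H s : uniq s -> monomial_on s [ffun i => if i == j then k else 0] =
    if j \in s then upow (z j) (zi j) k else 1.
  rewrite /monomial_on; elim: s => [|i s IH]; first by rewrite big_nil.
  move=> /= /andP[is_ us]; rewrite big_cons IH // ffunE inE eq_sym.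
  case: (eqVneq j i) => [ji|ji] /=; last by rewrite mul1r.
  by rewrite ji (negPf is_) mulr1.
by rewrite H ?enum_uniq // mem_enum.
Qed.

Lemma monomial0 : monomial 0 = 1.
Proof. by rewrite /monomial /monomial_on big1 // => i _; rewrite ffunE. Qed.

(** Row [j] of the form is concentrated at [i], so moving [z j] across a monomial detects the
    exponent [m i] alone. *)
Lemma monomial_conj i j : Om j i != 0 -> (forall k, k != i -> Om j k = 0) ->
  exists g (s : int), s != 0 /\
    forall m, monomial g * monomial m = q ^ (s * m i) *: (monomial m * monomial g).
Proof.
move=> ji0 jk0; exists [ffun k => if k == j then 1 else 0], (Om j i); split=> // m.
rewrite monomial_single [upow _ _ 1]expr1 -/(qcomm _ _ _).
have := qcommC (@qcomm_monomial_on (enum 'I_N) m (z j) (fun k => - Om j k) _).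
rewrite big_enum (bigD1 i) //= big1 => [|k ki]; last by rewrite jk0 // oppr0 mul0r.
by rewrite addr0 mulNr opprK; apply=> k; apply/qcommC/z_comm.
Qed.

Definition monomial_comb (a : A) : Prop := exists (S : {fset Gam}) (f : Gam -> C),
  a = \sum_(m <- S) f m *: monomial m.

Lemma monomial_comb_single c m : monomial_comb (c *: monomial m).
Proof.
by exists [fset m]%fset, (fun _ => c); rewrite big_seq_fset1.
Qed.

Lemma monomial_comb_lin c u v :
  monomial_comb u -> monomial_comb v -> monomial_comb (c *: u + v).
Proof.
move=> [S [f ->]] [T [g ->]]; exists (S `|` T)%fset, (fun m =>
  c * (if m \in S then f m else 0) + (if m \in T then g m else 0)).
rewrite (sum_fset_widen _ _ (fsubsetUl S T)).
rewrite (sum_fset_widen _ g (fsubsetUr S T)).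
rewrite scaler_sumr -big_split; apply: eq_bigr => m _ /=.
by rewrite scalerDl scalerA.
Qed.

Lemma monomial_combM u v :
  monomial_comb u -> monomial_comb v -> monomial_comb (u * v).
Proof.
have sumP (S : {fset Gam}) F : (forall m, monomial_comb (F m)) ->
    monomial_comb (\sum_(m <- S) F m).
  move=> FP; apply: big_ind => [|a b|m _]; last exact: FP.
    by rewrite -(scale0r (monomial 0)); apply: monomial_comb_single.
  by move=> aP bP; rewrite -[a]scale1r; apply: monomial_comb_lin.
move=> [S [f ->]] [T [g ->]]; rewrite mulr_suml; apply: (sumP S) => m.
rewrite mulr_sumr; apply: sumP => k.
have [l lE] := monomialM m k.
by rewrite -scalerAl -scalerAr lE !scalerA; apply: monomial_comb_single.
Qed.

End Frame.
End QCommute.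

(** * Invertible bimodules over a simple Ore domain *)

Section Bimodules.
Variables (C : fieldType) (A : algType C).

Section Actions.
Variables (M : lmodType C) (lM : A -> M -> M) (rM : M -> A -> M).
Hypothesis M_bimod : is_bimod lM rM.

Lemma bimod_linl c a b m : lM (c *: a + b) m = c *: lM a m + lM b m.
Proof. by case: M_bimod => [[H _] _ _ _ _]. Qed.
Lemma bimod_linr a c m m' : lM a (c *: m + m') = c *: lM a m + lM a m'.
Proof. by case: M_bimod => [[_ H] _ _ _ _]. Qed.
Lemma bimod_rlinr c a b m : rM m (c *: a + b) = c *: rM m a + rM m b.
Proof. by case: M_bimod => [_ [H _] _ _ _]. Qed.
Lemma bimod_rlinl a c m m' : rM (c *: m + m') a = c *: rM m a + rM m' a.
Proof. by case: M_bimod => [_ [_ H] _ _ _]. Qed.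
Lemma bimod_l1 m : lM 1 m = m.
Proof. by case: M_bimod => [_ _ H _ _]; case: (H m). Qed.
Lemma bimod_r1 m : rM m 1 = m.
Proof. by case: M_bimod => [_ _ H _ _]; case: (H m). Qed.
Lemma bimod_lM a b m : lM (a * b) m = lM a (lM b m).
Proof. by case: M_bimod => [_ _ _ H _]; case: (H a b m). Qed.
Lemma bimod_rM a b m : rM m (a * b) = rM (rM m a) b.
Proof. by case: M_bimod => [_ _ _ H _]; case: (H a b m). Qed.
Lemma bimod_lr a b m : lM a (rM m b) = rM (lM a m) b.
Proof. by case: M_bimod. Qed.

Lemma bimod_lZ c a m : lM (c *: a) m = c *: lM a m.
Proof. exact: (linear_mapZ (f := lM^~ m) (fun c a b => bimod_linl c a b m)). Qed.
Lemma bimod_rZ c a m : rM m (c *: a) = c *: rM m a.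
Proof. exact: (linear_mapZ (fun c a b => bimod_rlinr c a b m)). Qed.
Lemma bimod_Zr c a m : rM (c *: m) a = c *: rM m a.
Proof. exact: (linear_mapZ (f := rM^~ a) (bimod_rlinl a)). Qed.

End Actions.

(** This is [tensor_iso] with target [A], with uniqueness separated from any balanced map [g]: it
    amounts to saying that the values of [beta] span [A]. *)
Definition is_pairing (M : lmodType C) (lM : A -> M -> M) (rM : M -> A -> M)
    (N : lmodType C) (lN : A -> N -> N) (rN : N -> A -> N) (beta : M -> N -> A) :=
  [/\ balanced rM lN beta,
      forall a m n, beta (lM a m) n = a * beta m n,
      forall m n b, beta m (rN n b) = beta m n * b,
      forall (Q : lmodType C) (g : M -> N -> Q), balanced rM lN g ->
        exists h : A -> Q,
          (forall c p p', h (c *: p + p') = c *: h p + h p') /\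
          forall m n, g m n = h (beta m n)
    & forall (Q : lmodType C) (h h' : A -> Q),
        (forall c p p', h (c *: p + p') = c *: h p + h p') ->
        (forall c p p', h' (c *: p + p') = c *: h' p + h' p') ->
        (forall m n, h (beta m n) = h' (beta m n)) -> forall p, h p = h' p].

Lemma tensor_iso_pairing (M : lmodType C) (lM : A -> M -> M) (rM : M -> A -> M)
    (N : lmodType C) (lN : A -> N -> N) (rN : N -> A -> N) :
  tensor_iso lM rM lN rN (@twl _ A) (twr id) ->
  exists beta, is_pairing lM rM lN rN beta.
Proof.
move=> [beta [bal bl br univ]]; exists beta; split=> //.
- by move=> Q g g_bal; have [[h [h_lin hE]] _] := univ Q g g_bal; exists h.
- move=> Q h h' h_lin h'_lin hh'.
  have g_bal : balanced rM lN (fun m n => h (beta m n)).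
    case: bal => b1 b2 b3; split=> [c m m' n|c m n n'|m a n].
    + by rewrite b1 h_lin.
    + by rewrite b2 h_lin.
    + by rewrite b3.
  by have [_] := univ Q _ g_bal; apply.
Qed.

(* The two isomorphisms M (x) N -> A and N (x) M -> A need not be
   compatible, but the two ways of contracting M (x) N (x) M to M differ by a
   bimodule endomorphism [theta] of M. *)
Lemma pairing_defect (M : lmodType C) (lM : A -> M -> M) (rM : M -> A -> M)
    (N : lmodType C) (lN : A -> N -> N) (rN : N -> A -> N) beta beta' :
  is_bimod lM rM -> is_bimod lN rN ->
  is_pairing lM rM lN rN beta -> is_pairing lN rN lM rM beta' ->
  exists theta : M -> M,
    [/\ forall c u v, theta (c *: u + v) = c *: theta u + theta v,
        forall a m, theta (lM a m) = lM a (theta m),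
        forall m b, theta (rM m b) = rM (theta m) b
      & forall m n m', rM m (beta' n m') = lM (beta m n) (theta m')].
Proof.
move=> bM bN [[b1 b2 b3] bl br bex bext] [[b1' b2' b3'] bl' br' _ _].
(* For fixed [m'] the left side is balanced in [m] and [n], hence equals [h (beta m n)] with [h]
   linear. On the span of the values of [beta] one checks that [h] is left [A]-linear, so [t = h 1]
   works. *)
have /choice[theta thE] : forall m', exists t, forall m n,
    rM m (beta' n m') = lM (beta m n) t.
  move=> m'; have [] := bex M (fun m n => rM m (beta' n m')).
    split=> [c m1 m2 n|c m n1 n2|m a n].
    - exact: (bimod_rlinl bM).
    - by rewrite b1' (bimod_rlinr bM).
    - by rewrite bl' (bimod_rM bM).
  move=> h [h_lin hE]; exists (h 1) => m n; rewrite hE.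
  set p := beta m n; rewrite -[in LHS](mulr1 p); move: (1 : A) => r.
  apply: (bext M (fun r => h (p * r)) (fun r => lM p (h r))) r.
  - by move=> c u v; rewrite mulrDr -scalerAr h_lin.
  - by move=> c u v; rewrite h_lin (bimod_linr bM).
  - by move=> k l; rewrite -bl -!hE (bimod_lr bM).
(* As the values of [beta] span [A], they contain 1 in their span and separate the elements of M. *)
have ext u v : (forall m n, lM (beta m n) u = lM (beta m n) v) -> u = v.
  move=> uv; rewrite -[u](bimod_l1 bM) -[v](bimod_l1 bM).
  by apply: (bext M (fun p => lM p u) (fun p => lM p v)) => // c p p';
    apply: (bimod_linl bM).
exists theta; split=> //.
- move=> c u v; apply: ext => m n.
  by rewrite (bimod_linr bM) -!thE b2' (bimod_rlinr bM).
- move=> a m'; apply: ext => m n.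
  by rewrite -thE -b3' thE br (bimod_lM bM).
- move=> m' b; apply: ext => m n.
  by rewrite (bimod_lr bM) -!thE br' (bimod_rM bM).
Qed.

Section Invertible.
Variables (M : lmodType C) (lM : A -> M -> M) (rM : M -> A -> M).
Variables (N : lmodType C) (lN : A -> N -> N) (rN : N -> A -> N).
Variables (beta : M -> N -> A) (beta' : N -> M -> A).
Hypothesis M_bimod : is_bimod lM rM.
Hypothesis N_bimod : is_bimod lN rN.
Hypothesis betaP : is_pairing lM rM lN rN beta.
Hypothesis betaP' : is_pairing lN rN lM rM beta'.

Lemma pairing_0l n : beta 0 n = 0.
Proof.
have [[b1 _ _] _ _ _ _] := betaP.
by apply: (@linear_map0 _ _ _ (beta^~ n)) => c u v; apply: b1.
Qed.

Lemma bimod_l0 a : lM a 0 = 0.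
Proof. exact: linear_map0 (bimod_linr M_bimod a). Qed.

Lemma bimod_0l m : lM 0 m = 0.
Proof.
by apply: (@linear_map0 _ _ _ (lM^~ m)) => c u v; apply: (bimod_linl M_bimod).
Qed.

Lemma bimod_r0 m : rM m 0 = 0.
Proof.
by apply: (@linear_map0 _ _ _ (rM m)) => c u v; apply: (bimod_rlinr M_bimod).
Qed.

Lemma bimod_0r a : rM 0 a = 0.
Proof.
by apply: (@linear_map0 _ _ _ (rM^~ a)) => c u v; apply: (bimod_rlinl M_bimod).
Qed.

(** If [theta m' = 0], the defect relation gives [M beta'(N, m') = 0], so [beta'(N, m') = 0]. The
    relation for N then gives [beta(m', N) = 0], and the one for M gives [m' A = 0]. *)
Lemma pairing_defect_inj : exists theta : M -> M,
    [/\ forall c u v, theta (c *: u + v) = c *: theta u + theta v,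
        forall a m, theta (lM a m) = lM a (theta m),
        forall m b, theta (rM m b) = rM (theta m) b,
        forall m n m', rM m (beta' n m') = lM (beta m n) (theta m')
      & forall m, theta m = 0 -> m = 0].
Proof.
have [theta [th_lin thl thr thE]] := pairing_defect M_bimod N_bimod betaP betaP'.
have [theta' [_ _ _ thE']] := pairing_defect N_bimod M_bimod betaP' betaP.
exists theta; split=> // m' thm'.
have [[b1 b2 b3] bl br bex bext] := betaP.
have [[b1' b2' b3'] bl' br' bex' bext'] := betaP'.
have b'0 n : beta' n m' = 0.
  suff H : forall m, rM m (beta' n m') = 0.
    rewrite -[LHS]mul1r; apply: (bext' A (fun p => p * beta' n m') (fun _ => 0)).
    - by move=> c u v; rewrite mulrDl scalerAl.
    - by move=> c _ _; rewrite scaler0 addr0.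
    - move=> k l; rewrite -br' H.
      by apply: (@linear_map0 _ _ _ (beta' k)) => c u v; apply: b2'.
  by move=> m; rewrite thE thm' bimod_l0.
have b0 n' : beta m' n' = 0.
  rewrite -[LHS]mul1r; apply: (bext A (fun p => p * beta m' n') (fun _ => 0)).
  - by move=> c u v; rewrite mulrDl scalerAl.
  - by move=> c _ _; rewrite scaler0 addr0.
  - move=> k l; rewrite -br thE' b'0.
    have -> : lN 0 (theta' n') = 0.
      by apply: (@linear_map0 _ _ _ (lN^~ _)) => c u v; apply: (bimod_linl N_bimod).
    by apply: (@linear_map0 _ _ _ (beta k)) => c u v; apply: b2.
rewrite -[LHS](bimod_r1 M_bimod).
apply: (bext' M (fun p => rM m' p) (fun _ => 0)).
- by move=> c u v; apply: (bimod_rlinr M_bimod).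
- by move=> c _ _; rewrite scaler0 addr0.
- by move=> n m''; rewrite thE b0 bimod_0l.
Qed.

Lemma right_action_faithful b : (forall m, rM m b = 0) -> b = 0.
Proof.
have [[_ b2' _] _ br' _ bext'] := betaP'.
move=> Mb; rewrite -[b]mul1r; apply: (bext' A (fun p => p * b) (fun _ => 0)).
- by move=> c u v; rewrite mulrDl scalerAl.
- by move=> c _ _; rewrite scaler0 addr0.
- move=> n m; rewrite -br' Mb.
  by apply: (@linear_map0 _ _ _ (beta' n)) => c u v; apply: b2'.
Qed.

Hypothesis A_domain : forall a b : A, a != 0 -> b != 0 -> a * b != 0.
Hypothesis A_ore : forall a b : A, a != 0 -> b != 0 ->
  exists c d, c * a = d * b /\ c * a != 0.
Hypothesis A_simple : forall (J : A -> Prop) (a : A),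
  is_ideal J -> J a -> a != 0 -> J 1.

(** If [beta'(N, m)] vanished, the defect relation would give [A theta(m) = 0], against injectivity
    of [theta]. *)
Lemma pairing_nondeg m : m <> 0 -> exists n, beta' n m != 0.
Proof.
have [theta [_ _ _ thE th_inj]] := pairing_defect_inj.
have [_ _ _ _ bext] := betaP.
move=> m0; apply: contrapT => H; apply: m0; apply: th_inj.
have b0 n : beta' n m = 0.
  by apply/eqP; apply: contraT => bn; case: H; exists n.
rewrite -[LHS](bimod_l1 M_bimod).
apply: (bext M (fun p => lM p (theta m)) (fun _ => 0)).
- by move=> c u v; apply: (bimod_linl M_bimod).
- by move=> c _ _; rewrite scaler0 addr0.
- by move=> k l; rewrite -thE b0 bimod_r0.
Qed.

(** The Ore condition gives nonzero values [beta'(n1, m1)] and [beta'(n2, m2)] a common nonzero left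
    multiple. By faithfulness some [m] is not killed by it, and the defect relation carries the
    equality back to M. *)
Lemma invertible_uniform m1 m2 : m1 <> 0 -> m2 <> 0 ->
  exists p p', lM p m1 = lM p' m2 /\ lM p m1 <> 0.
Proof.
have [theta [th_lin thl _ thE th_inj]] := pairing_defect_inj.
have [_ bl' _ _ _] := betaP'.
move=> /pairing_nondeg[n1 b1] /pairing_nondeg[n2 b2].
have [c1 [c2 [cE c0]]] := A_ore b1 b2.
have [m ma] : exists m, rM m (c1 * beta' n1 m1) <> 0.
  apply: contrapT => H; move/eqP: c0; apply; apply: right_action_faithful => m.
  by apply: contrapT => ma; apply: H; exists m.
exists (beta m (lN c1 n1)), (beta m (lN c2 n2)).
have E1 : theta (lM (beta m (lN c1 n1)) m1) = rM m (c1 * beta' n1 m1).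
  by rewrite thl -thE bl'.
have E2 : theta (lM (beta m (lN c2 n2)) m2) = rM m (c1 * beta' n1 m1).
  by rewrite thl -thE bl' cE.
split; last by move=> H; apply: ma; rewrite -E1 H (linear_map0 th_lin).
apply/eqP; rewrite -subr_eq0; apply/eqP/th_inj.
by rewrite (linear_mapB th_lin) E1 E2 subrr.
Qed.

(** By uniformity a nonzero [m] with [beta m n0 = 0] would share a nonzero multiple [p' m0] with
    [m0], forcing [p' * beta m0 n0 = 0] in a domain. *)
Lemma invertible_embeds : exists n0,
  (exists m, beta m n0 != 0) /\ forall m, beta m n0 = 0 -> m = 0.
Proof.
have [_ bl _ _ bext] := betaP.
have [n0 [m0 b0]] : exists n m, beta m n != 0.
  apply: contrapT => H.
  have /eqP : (1 : A) = 0.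
    apply: (bext A id (fun _ => 0)) => // [c _ _|m n].
      by rewrite scaler0 addr0.
    by apply/eqP; apply: contraT => bn; case: H; exists n, m.
  by rewrite oner_eq0.
exists n0; split; first by exists m0.
move=> m bm; apply: contrapT => m_neq0.
have m00 : m0 <> 0 by move=> m00; move: b0; rewrite m00 pairing_0l eqxx.
have [p [p' [pE p0]]] := invertible_uniform m_neq0 m00.
have p'0 : p' != 0 by apply/eqP => p'0; apply: p0; rewrite pE p'0 bimod_0l.
by have := A_domain p'0 b0; rewrite -bl -pE bl bm mulr0 eqxx.
Qed.

Lemma invertible_torsion_free a m : lM a m = 0 -> a = 0 \/ m = 0.
Proof.
have [_ bl _ _ _] := betaP; have [n0 [_ n0P]] := invertible_embeds.
move=> am; have [->|a0] := eqVneq a 0; first by left.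
right; apply: n0P; apply/eqP; apply: contraT => bm.
by have := A_domain a0 bm; rewrite -bl am pairing_0l eqxx.
Qed.

(* If v A is contained in A v then [beta' N v] is a nonzero two-sided ideal,
   so M is generated by [theta v]. *)
Lemma invertible_cyclic v : v <> 0 -> (forall b, exists a, rM v b = lM a v) ->
  exists psi : A -> A, alg_aut psi /\ bimod_iso lM rM (@twl _ A) (twr psi).
Proof.
have [theta [th_lin thl thr thE th_inj]] := pairing_defect_inj.
have [[b1' b2' b3'] bl' br' _ _] := betaP'.
move=> v0 /choice[psi psiE].
have v_free a : lM a v = 0 -> a = 0 by move=> /invertible_torsion_free[].
have v_cancel a b : lM a v = lM b v -> a = b.
  move=> ab; apply/eqP; rewrite -subr_eq0; apply/eqP/v_free.
  rewrite (linear_mapB (f := lM^~ v)) ?ab ?subrr // => *.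
  exact: (bimod_linl M_bimod).
have psi_hom : alg_hom psi.
  split=> [c a b|a b|]; apply: v_cancel; rewrite -psiE.
  - by rewrite (bimod_rlinr M_bimod) (bimod_linl M_bimod) !psiE.
  - by rewrite (bimod_rM M_bimod) psiE -(bimod_lr M_bimod) psiE (bimod_lM M_bimod).
  - by rewrite (bimod_r1 M_bimod) (bimod_l1 M_bimod).
have [psi_lin _ _] := psi_hom.
have [n0 n0v] := pairing_nondeg v0.
have [n nv] : exists n, 1 = beta' n v.
  apply: (A_simple (J := fun a => exists n, a = beta' n v)) n0v; last by exists n0.
  split=> [_ _ [k ->] [l ->]|_ b [k ->]|_ b [k ->]].
  - by exists (k + l); have := b1' 1 k l v; rewrite !scale1r => ->.
  - by exists (lN b k); rewrite bl'.
  - by exists (rN k (psi b)); rewrite -br' psiE b3'.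
pose w := theta v.
(* The defect relation for [beta' n v = 1]. *)
have Mw m : m = lM (beta m n) w by rewrite /w -thE -nv (bimod_r1 M_bimod).
have w_neq0 : w <> 0 by move=> /th_inj.
have w_cancel a b : lM a w = lM b w -> a = b.
  move=> ab; apply: v_cancel; apply/eqP; rewrite -subr_eq0; apply/eqP/th_inj.
  by rewrite (linear_mapB th_lin) !thl ab subrr.
have wE b : rM w b = lM (psi b) w by rewrite -thr psiE thl.
(* If [psi c = 0] then [M c = A w c = A psi(c) w = 0], and the right action is faithful. *)
have psi_inj : injective psi.
  move=> a b ab; apply/eqP; rewrite -subr_eq0; apply/eqP.
  apply: right_action_faithful => m; rewrite [m]Mw -(bimod_lr M_bimod) wE.
  by rewrite (linear_mapB psi_lin) ab subrr bimod_0l bimod_l0.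
(* The preimage of [a] is [beta'(n, a v)]: the defect relation gives [w beta'(n, a v) = beta(w, n)
   theta(a v) = a w]. *)
have /choice[phi phiK] : forall a, exists b, psi b = a.
  have bw : beta w n = 1 by apply: w_cancel; rewrite -Mw (bimod_l1 M_bimod).
  move=> a; exists (beta' n (lM a v)); apply: w_cancel.
  by rewrite -wE thE bw (bimod_l1 M_bimod) thl.
exists psi; split.
  by split=> //; exists phi => // a; apply: psi_inj; rewrite phiK.
exists (fun m => beta m n); rewrite /twl /twr; split.
- by exists (fun a => lM a w) => [m|a]; [rewrite -Mw | apply: w_cancel; rewrite -Mw].
- by move=> c m m'; apply: w_cancel; rewrite (bimod_linl M_bimod) -!Mw.
- by move=> a m; apply: w_cancel; rewrite (bimod_lM M_bimod) -!Mw.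
- move=> m b; apply: w_cancel.
  by rewrite (bimod_lM M_bimod) -wE (bimod_lr M_bimod) -!Mw.
Qed.

End Invertible.
End Bimodules.

(** * Every invertible bimodule is a twist *)

Section Surjectivity.
Variables (C : numClosedFieldType) (A : algType C) (q : C) (N : nat).
Local Notation Gam := {ffun 'I_N -> int}.
Variable e : Gam -> A.
Hypothesis q_neq0 : q != 0.
Hypothesis q_nroot : forall k : nat, (0 < k)%N -> q ^+ k != 1.
Hypothesis e0 : e 0 = 1.
Hypothesis eM : forall m k, qsim q (e m * e k) (e (m + k)).
Hypothesis e_conj : forall i, exists g (s : int), s != 0 /\
  forall m, e g * e m = q ^ (s * m i) *: (e m * e g).
Hypothesis e_span : forall a, exists (S : {fset Gam}) (f : Gam -> C),
  a = \sum_(m <- S) f m *: e m.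
Variables z zi : 'I_N -> A.
Hypothesis z_unit : forall i, z i * zi i = 1 /\ zi i * z i = 1.
Hypothesis z_comm : forall i j, exists k, qcomm q k (z i) (z j).
Hypothesis z_ind : forall P : A -> Prop, P 1 ->
  (forall c u v, P u -> P v -> P (c *: u + v)) ->
  (forall u v, P u -> P v -> P (u * v)) ->
  (forall i, P (z i)) -> (forall i, P (zi i)) -> forall a, P a.

Variables (M : lmodType C) (lM : A -> M -> M) (rM : M -> A -> M).
Variables (N' : lmodType C) (lN : A -> N' -> N') (rN : N' -> A -> N').
Variables (beta : M -> N' -> A) (beta' : N' -> M -> A).
Hypothesis M_bimod : is_bimod lM rM.
Hypothesis N_bimod : is_bimod lN rN.
Hypothesis betaP : is_pairing lM rM lN rN beta.
Hypothesis betaP' : is_pairing lN rN lM rM beta'.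

Let domain := quantum_torus_domain q_neq0 q_nroot e0 eM e_conj e_span.
Let ore := quantum_torus_ore q_neq0 q_nroot e0 eM e_conj e_span.
Let uniform := invertible_uniform M_bimod N_bimod betaP betaP' ore.
Local Notation cf := (cf e_span).
Local Notation has_deg := (has_deg e_span).
Let degM := @has_degM _ _ _ _ _ q_neq0 q_nroot e0 eM e_conj e_span.
Let deg_exists := @has_deg_exists _ _ _ _ e_span.

Variable n0 : N'.
Hypothesis n0_inj : forall m, beta m n0 = 0 -> m = 0.
(** This embeds M in [A] as a left ideal; degrees and supports of elements of M are those of their
    images. *)
Let phi m := beta m n0.

Let phi_lin c u v : phi (c *: u + v) = c *: phi u + phi v.
Proof. by case: betaP => [[b1 _ _] _ _ _ _]; apply: b1. Qed.

Let phiM a m : phi (lM a m) = a * phi m.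
Proof. by case: betaP => [_ bl _ _ _]; apply: bl. Qed.

Let phi_neq0 m : m <> 0 -> phi m != 0.
Proof. by move=> m0; apply/eqP => /n0_inj. Qed.

Let rM_unitK u ui m : u * ui = 1 -> rM (rM m u) ui = m.
Proof. by move=> uui; rewrite -(bimod_rM M_bimod) uui (bimod_r1 M_bimod). Qed.

Let rM_unit_neq0 u ui m : u * ui = 1 -> m <> 0 -> rM m u <> 0.
Proof.
by move=> uui m0 mu; apply: m0; rewrite -(rM_unitK m uui) mu (bimod_0r M_bimod).
Qed.

Variable m0 : M.
Hypothesis m0_neq0 : m0 <> 0.

(* By uniformity any two nonzero elements of M have a common nonzero left
   multiple, so the shift of degrees does not depend on the element. *)
Lemma unit_shift (lam : Gam -> int) u ui :
  {morph lam : m k / m + k} -> u * ui = 1 ->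
  exists D, forall m d, has_deg lam (phi m) d -> has_deg lam (phi (rM m u)) (d + D).
Proof.
move=> lamD uui.
have [d0 d0P] := deg_exists lam (phi_neq0 m0_neq0).
have [d1 d1P] := deg_exists lam (phi_neq0 (rM_unit_neq0 uui m0_neq0)).
exists (d1 - d0) => m d dP.
have m_neq0 : m <> 0.
  move=> m_eq0; have [_ [k [+ _]]] := dP; rewrite m_eq0.
  by rewrite (linear_map0 phi_lin) (cf0 q_neq0 q_nroot e0 eM e_conj) eqxx.
have [p [p' [pE pm0]]] := uniform m_neq0 m0_neq0.
have p_neq0 : p != 0.
  by apply/eqP => p0; apply: pm0; rewrite p0 (bimod_0l M_bimod).
have p'_neq0 : p' != 0.
  by apply/eqP => p0; apply: pm0; rewrite pE p0 (bimod_0l M_bimod).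
have [x xP] := deg_exists lam (phi_neq0 (rM_unit_neq0 uui m_neq0)).
have [dp dpP] := deg_exists lam p_neq0; have [dp' dpP'] := deg_exists lam p'_neq0.
(* The degree of [p m = p' m0] is computed in two ways, before and after right multiplication by
   [u]; subtracting gives [x - d = d1 - d0]. *)
have E1 : dp + d = dp' + d0.
  apply: (has_deg_uniq (e_span := e_span) (lam := lam) (a := p * phi m)).
    exact: degM.
  by rewrite -phiM pE phiM; apply: degM.
have E2 : dp + x = dp' + d1.
  apply: (has_deg_uniq (e_span := e_span) (lam := lam) (a := p * phi (rM m u))).
    exact: degM.
  by rewrite -phiM (bimod_lr M_bimod) pE -(bimod_lr M_bimod) phiM; apply: degM.
by have -> : d + (d1 - d0) = x by lia.
Qed.

(** The shifts along [lam] and [- lam] have sum at least 0. Those of the inverse unit are their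
    negatives, so the sum is 0. *)
Lemma unit_shift_opp (lam : Gam -> int) u ui :
  {morph lam : m k / m + k} -> u * ui = 1 -> ui * u = 1 ->
  exists D, forall m d,
    (has_deg lam (phi m) d -> has_deg lam (phi (rM m u)) (d + D)) /\
    (has_deg (fun m => - lam m) (phi m) d ->
       has_deg (fun m => - lam m) (phi (rM m u)) (d - D)).
Proof.
move=> lamD uui uiu.
have lamDN : {morph (fun m => - lam m) : m k / m + k}.
  by move=> m k /=; rewrite lamD opprD.
have [d0 d0P] := deg_exists lam (phi_neq0 m0_neq0).
have [d1 d1P] := deg_exists (fun m => - lam m) (phi_neq0 m0_neq0).
(* The width [deg lam + deg (- lam)] is nonnegative, so it cannot decrease
   forever under iteration of [u]. *)
have width v vi (D D' : int) : v * vi = 1 ->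
    (forall m d, has_deg lam (phi m) d -> has_deg lam (phi (rM m v)) (d + D)) ->
    (forall m d, has_deg (fun m => - lam m) (phi m) d ->
      has_deg (fun m => - lam m) (phi (rM m v)) (d + D')) ->
    0 <= D + D'.
  move=> vvi DP DP'.
  have iter (k : nat) : exists m, has_deg lam (phi m) (d0 + k%:Z * D) /\
      has_deg (fun m => - lam m) (phi m) (d1 + k%:Z * D').
    elim: k => [|k [m [h h']]]; first by exists m0; rewrite !mul0r !addr0.
    have step (d D0 : int) : d + k.+1%:Z * D0 = d + k%:Z * D0 + D0.
      by rewrite intS mulrDl mul1r addrCA addrC.
    by exists (rM m v); rewrite !step; split; [apply: DP | apply: DP'].
  (* If [D + D'] were at most -1, the width [d0 + d1 + K (D + D')] would be negative for
     [K = |d0 + d1| + 1]. *)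
  have [m [[h _] [h' [k [mk lk]]]]] := iter `|d0 + d1|.+1.
  have := h k mk; set K : int := `|d0 + d1|.+1 in lk *.
  move=> kd; rewrite leNgt; apply/negP => DD.
  have : K * (D + D') <= K * (- 1) by rewrite ler_pM2l //; lia.
  by rewrite mulrDr mulrN1; move: lk kd; rewrite /K; lia.
have [D DP] := unit_shift lamD uui; have [D' DP'] := unit_shift lamDN uui.
have [E EP] := unit_shift lamD uiu; have [E' EP'] := unit_shift lamDN uiu.
have ED : D + E = 0.
  apply: (addrI d0); rewrite addr0 addrA.
  apply: (has_deg_uniq (e_span := e_span) (lam := lam) (a := phi m0)) => //.
  by have := EP _ _ (DP _ _ d0P); rewrite rM_unitK.
have ED' : D' + E' = 0.
  apply: (addrI d1); rewrite addr0 addrA.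
  apply: (has_deg_uniq (e_span := e_span) (lam := fun m => - lam m)
                       (a := phi m0)) => //.
  by have := EP' _ _ (DP' _ _ d1P); rewrite rM_unitK.
have := width u ui D D' uui DP DP'; have := width ui u E E' uiu EP EP'.
move=> h h'; exists D => m d; split; first exact: DP.
have -> : - D = D' by lia.
exact: DP'.
Qed.

Lemma eigenvector_exists : exists v, v <> 0 /\
  forall j, exists g (c : C), c != 0 /\ lM (e g) (rM v (z j)) = c *: v.
Proof.
have /choice[D DP] : forall ji : 'I_N * 'I_N, exists D, forall m d,
    (has_deg (fun k => k ji.2) (phi m) d ->
       has_deg (fun k => k ji.2) (phi (rM m (z ji.1))) (d + D)) /\
    (has_deg (fun k => - k ji.2) (phi m) d ->
       has_deg (fun k => - k ji.2) (phi (rM m (z ji.1))) (d - D)).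
  move=> [j i]; have [zzi ziz] := z_unit j.
  exact: (unit_shift_opp (lam := fun k : Gam => k i) (@coord_morph N i) zzi ziz).
(* Multiplying by this monomial undoes the degree shifts caused by [z j]. *)
pose g j : Gam := [ffun i => - D (j, i)].
pose T j m := lM (e (g j)) (rM m (z j)).
have [B BP] := bounded_support q_neq0 q_nroot e0 eM e_conj e_span (phi m0).
(* The box is chosen to contain the support of [phi m0]; [io] enumerates it, so finitely many
   coefficients determine an element of [V]. *)
pose V m := forall k, cf (phi m) k != 0 -> forall i, (`|k i| <= B)%N.
pose io (f : {ffun 'I_N -> 'I_(2 * B).+1}) : Gam :=
  [ffun i => (f i : nat)%:Z - B%:Z].
have cflin := cf_lin q_neq0 q_nroot e0 eM e_conj.
have T_inj j v : T j v = 0 -> v = 0.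
  have [zzi _] := z_unit j; move=> Tv; apply: contrapT => v0.
  have /eqP := phi_neq0 (rM_unit_neq0 zzi v0).
  have : phi (T j v) = 0 by rewrite Tv (linear_map0 phi_lin).
  rewrite /T phiM => H; apply; apply/eqP; apply: contraT => pv0.
  have := domain (e_neq0 q_neq0 e0 eM (g j)) pv0; by rewrite H eqxx.
have [||||||||j k|v [Vv v_neq0 vP]] :=
    @common_eigenvector_qcomm C q M V _ (fun m f => cf (phi m) (io f)) N T m0
      q_neq0 q_nroot.
- move=> c u v Vu Vv k; rewrite phi_lin cflin => H i.
  have [uk|uk] := eqVneq (cf (phi u) k) 0; last exact: Vu.
  by apply: (Vv k); apply: contraNneq H => vk; rewrite uk vk mulr0 addr0.
- by move=> c u v d; rewrite phi_lin cflin.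
- move=> v Vv H; apply: n0_inj; apply: (cf_eq0 (e_span := e_span)) => k.
  apply/eqP; apply: contraT => kP.
  have lt i : (`|(k i + B%:Z)%R| < (2 * B).+1)%N.
    by have := Vv k kP i; move: (k i) => t; lia.
  suff kE : k = io [ffun i => Ordinal (lt i)] by move: kP; rewrite kE H eqxx.
  apply/ffunP => i; rewrite !ffunE /=.
  by have := Vv k kP i; move: (k i) => t; lia.
- exact: BP.
- exact/eqP.
- move=> j c u v; rewrite /T (bimod_rlinl M_bimod); exact: (bimod_linr M_bimod).
- move=> j v Vv; have [->|/eqP v0] := eqVneq v 0.
    rewrite /T (bimod_0r M_bimod) (bimod_l0 M_bimod) => k.
    by rewrite (linear_map0 phi_lin) (cf0 q_neq0 q_nroot e0 eM e_conj) eqxx.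
  move=> k Tk i.
  (* [T j] preserves the degrees along [k i] and [- k i], that is, the extreme values of each
     coordinate, so the support stays in the box. *)
  have degT lam d (Dl : int) : {morph lam : m k / m + k} ->
      has_deg lam (phi (rM v (z j))) (d + Dl) -> lam (g j) = - Dl ->
      has_deg lam (phi (T j v)) d.
    move=> lamD dP lg; rewrite /T phiM.
    have -> : d = lam (g j) + (d + Dl) by rewrite lg addrC addrK.
    by apply: degM => //; apply: (has_deg_e q_neq0 q_nroot e0 eM e_conj).
  have [d dP] := deg_exists (fun k => k i) (phi_neq0 v0).
  have [d' dP'] := deg_exists (fun k => - k i) (phi_neq0 v0).
  have := degT _ _ _ (@coord_morph N i) ((DP (j, i) v d).1 dP).
  rewrite /g ffunE => /(_ erefl)[/(_ k Tk) kd _].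
  have cm : {morph (fun k : Gam => - k i) : m k / m + k}.
    by move=> m l; rewrite ffunE opprD.
  have := degT _ _ _ cm ((DP (j, i) v d').2 dP').
  rewrite /g ffunE => /(_ erefl)[/(_ k Tk) kd' _].
  have [_ [l [lv ld]]] := dP; have [_ [l' [lv' ld']]] := dP'.
  have := Vv l lv i; have := Vv l' lv' i.
  move: kd kd' ld ld'; move: (k i) (l i) (l' i) => t1 t2 t3; lia.
- exact: T_inj.
(* The monomials contribute [a - b] and the generators [l]; right multiplication puts [z k] before
   [z j]. *)
- have [l lE] := z_comm k j; have [a aE] := eM (g j) (g k).
  have [b bE] := eM (g k) (g j); exists (a - b + l) => v.
  have comm : e (g j) * e (g k) = q ^ (a - b) *: (e (g k) * e (g j)).
    by rewrite aE bE scalerA -expfzDr // subrK [g k + _]addrC.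
  rewrite /T !(bimod_lr M_bimod) -!(bimod_lM M_bimod) -!(bimod_rM M_bimod).
  rewrite comm lE (bimod_rZ M_bimod) (bimod_lZ M_bimod) (bimod_Zr M_bimod).
  by rewrite scalerA -expfzDr // addrC.
exists v; split; first exact/eqP.
move=> j; have [c cE] := vP j; exists (g j), c; split=> //.
apply: contraNneq v_neq0 => c0; apply/eqP/(T_inj j).
by rewrite cE c0 scale0r.
Qed.

(** The [b] with [v b] in [A v] form a subalgebra. From [e_g v z_j = c v], with [e_g] and [c]
    invertible, it contains [z_j] and its inverse. *)
Lemma eigenvector_cyclic : exists v, v <> 0 /\ forall b, exists a, rM v b = lM a v.
Proof.
have [v [v_neq0 vP]] := eigenvector_exists; exists v; split=> //.
apply: z_ind.
- by exists 1; rewrite (bimod_r1 M_bimod) (bimod_l1 M_bimod).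
- move=> c u w [a aE] [b bE]; exists (c *: a + b).
  by rewrite (bimod_rlinr M_bimod) (bimod_linl M_bimod) aE bE.
- move=> u w [a aE] [b bE]; exists (a * b).
  by rewrite (bimod_rM M_bimod) aE -(bimod_lr M_bimod) bE (bimod_lM M_bimod).
- move=> j; have [g [c [c0 cE]]] := vP j.
  have [w [we ew]] := e_unit q_neq0 e0 eM g.
  exists (c *: w); rewrite (bimod_lZ M_bimod).
  rewrite -[RHS](linear_mapZ (bimod_linr M_bimod w)).
  by rewrite -cE -(bimod_lM M_bimod) we (bimod_l1 M_bimod).
- move=> j; have [g [c [c0 cE]]] := vP j; have [zzi _] := z_unit j.
  exists (c^-1 *: e g); apply: (scalerI c0).
  rewrite -(bimod_Zr M_bimod) -cE (bimod_lZ M_bimod) scalerA divff // scale1r.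
  by rewrite -(bimod_lr M_bimod) rM_unitK.
Qed.

End Surjectivity.

(** * The monomials of the presented algebra *)

Lemma split_lshift m n (a : 'I_m) : split (lshift n a) = inl a.
Proof. exact: (unsplitK (inl a)). Qed.

Lemma split_rshift m n (a : 'I_n) : split (rshift m a) = inr a.
Proof. exact: (unsplitK (inr a)). Qed.

Section QuantumTorus.
Variables (C : fieldType) (A : algType C) (q : C) (n : nat).
Variables x xi y yi : 'I_n -> A.
Hypothesis q_neq0 : q != 0.
Hypothesis A_torus : is_quantum_torus q x xi y yi.

Definition torus_gen (f g : 'I_n -> A) (i : 'I_(n + n)) : A :=
  match split i with inl a => f a | inr b => g b end.

(** The matrix of the standard symplectic form on Z^(2n). *)
Definition torus_form (i j : 'I_(n + n)) : int :=
  match split i, split j with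
  | inl a, inr b => (a == b)%:Z
  | inr b, inl a => - (a == b)%:Z
  | _, _ => 0
  end.

Lemma torus_gen_unit i :
  torus_gen x y i * torus_gen xi yi i = 1 /\ torus_gen xi yi i * torus_gen x y i = 1.
Proof.
by have [[r1 r2 _ _ _] _] := A_torus; rewrite /torus_gen; case: split.
Qed.

Lemma torus_gen_comm i j :
  qcomm q (torus_form i j) (torus_gen x y i) (torus_gen x y j).
Proof.
have [[_ _ r3 r4 _] _] := A_torus.
have xy a b : qcomm q (a == b)%:Z (x a) (y b).
  rewrite /qcomm; have [->|ab] := eqVneq a b; first exact: r3.
  by rewrite expr0z scale1r; have [_ _] := r4 _ _ ab.
rewrite /torus_form /torus_gen; case: (split i) => a; case: (split j) => b.
- rewrite /qcomm expr0z scale1r; have [-> //|ab] := eqVneq a b.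
  by have [] := r4 _ _ ab.
- exact: xy.
- exact: qcommC.
- rewrite /qcomm expr0z scale1r; have [-> //|ab] := eqVneq a b.
  by have [] := r4 _ _ ab.
Qed.

(** The partner of [x_a] is [y_a] and conversely; every other generator commutes with the
    partner. *)
Lemma torus_form_nondeg i : exists j, torus_form j i != 0 /\
  forall k, k != i -> torus_form j k = 0.
Proof.
rewrite /torus_form; case: (split_ordP i) => a ->.
- exists (rshift n a); rewrite ?split_rshift ?split_lshift eqxx; split=> // k.
  case: (split_ordP k) => b ->; rewrite ?split_lshift ?split_rshift //.
  by rewrite (inj_eq (@lshift_inj _ _)) => /negPf ->.
- exists (lshift n a); rewrite ?split_rshift ?split_lshift eqxx; split=> // k.
  case: (split_ordP k) => b ->; rewrite ?split_lshift ?split_rshift //.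
  by rewrite (inj_eq (@rshift_inj _ _)) eq_sym => /negPf ->.
Qed.

Lemma torus_gen_ind (P : A -> Prop) : P 1 ->
  (forall c u v, P u -> P v -> P (c *: u + v)) ->
  (forall u v, P u -> P v -> P (u * v)) ->
  (forall i, P (torus_gen x y i)) -> (forall i, P (torus_gen xi yi i)) ->
  forall a, P a.
Proof.
move=> P1 P_lin PM Pz Pzi.
apply: (quantum_torus_ind P1 P_lin PM A_torus) => i.
- by have := Pz (lshift n i); rewrite /torus_gen split_lshift.
- by have := Pzi (lshift n i); rewrite /torus_gen split_lshift.
- by have := Pz (rshift n i); rewrite /torus_gen split_rshift.
- by have := Pzi (rshift n i); rewrite /torus_gen split_rshift.
Qed.

Definition torus_monomial := monomial (torus_gen x y) (torus_gen xi yi).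

(** Combinations of monomials form a subalgebra containing the generators and their inverses. *)
Lemma torus_monomial_span (a : A) :
  exists (S : {fset {ffun 'I_(n + n) -> int}}) (f : {ffun 'I_(n + n) -> int} -> C),
  a = \sum_(m <- S) f m *: torus_monomial m.
Proof.
have single i k : monomial_comb (torus_gen x y) (torus_gen xi yi)
    (upow (torus_gen x y i) (torus_gen xi yi i) k).
  rewrite -monomial_single -[monomial _ _ _]scale1r.
  exact: monomial_comb_single.
move: a; apply: torus_gen_ind.
- rewrite -(monomial0 (torus_gen x y) (torus_gen xi yi)) -[monomial _ _ _]scale1r.
  exact: monomial_comb_single.
- exact: monomial_comb_lin.
- exact: (monomial_combM q_neq0 torus_gen_unit torus_gen_comm).
- by move=> i; have := single i 1; rewrite /= expr1.
- by move=> i; have := single i (- 1); rewrite /= expr1.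
Qed.

Lemma torus_monomial_conj i : exists g (s : int), s != 0 /\
  forall m, torus_monomial g * torus_monomial m =
            q ^ (s * m i) *: (torus_monomial m * torus_monomial g).
Proof.
have [j [ji jk]] := torus_form_nondeg i.
exact: (monomial_conj q_neq0 torus_gen_unit torus_gen_comm ji jk).
Qed.

End QuantumTorus.

(* The natural map Aut(A)/Inn(A) -> Pic(A), psi |-> A_psi, for A = A_q^n,
   is a group isomorphism:
   (0) A_psi is invertible (the map lands in Pic);
   (1) A_psi ≅ A_phi  <->  psi ∈ Inn(A)∘phi  (well defined and injective);
   (2) A_psi ⊗_A A_phi ≅ A_(psi∘phi)         (homomorphism);
   (3) every invertible bimodule is ≅ A_psi  (surjective). *)
Theorem theorem6p1 (R : realType) (q : R[i]) (n : nat)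
  (A : algType R[i]) (x xi y yi : 'I_n -> A) :
  q != 0 -> (forall k : nat, (0 < k)%N -> q ^+ k != 1) -> (1 <= n)%N ->
  is_quantum_torus q x xi y yi ->
  [/\ (forall psi : A -> A, alg_aut psi ->
         invertible_bimod (@twl _ A) (twr psi)),
      (forall psi phi : A -> A, alg_aut psi -> alg_aut phi ->
         bimod_iso (@twl _ A) (twr psi) (@twl _ A) (twr phi) <->
         exists iota : A -> A, inner_aut iota /\ forall a, psi a = iota (phi a)),
      (forall psi phi : A -> A, alg_aut psi -> alg_aut phi ->
         tensor_iso (@twl _ A) (twr psi) (@twl _ A) (twr phi)
                    (@twl _ A) (twr (psi \o phi)))
    & (forall (M : lmodType R[i]) (lM : A -> M -> M) (rM : M -> A -> M),
         is_bimod lM rM -> invertible_bimod lM rM ->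
         exists psi : A -> A, alg_aut psi /\
           bimod_iso lM rM (@twl _ A) (twr psi))].
Proof.
move=> q_neq0 q_nroot _ A_torus; split.
- exact: twist_invertible.
- exact: twist_iso.
- by move=> psi phi psi_aut _; apply: twist_tensor psi_aut.1 _.
move=> M lM rM M_bimod [N [lN [rN [N_bimod MN NM]]]].
have [beta betaP] := tensor_iso_pairing MN.
have [beta' betaP'] := tensor_iso_pairing NM.
pose e := torus_monomial x xi y yi.
have e0 : e 0 = 1 by apply: monomial0.
have eM : forall m k, qsim q (e m * e k) (e (m + k)).
  exact: (monomialM q_neq0 (torus_gen_unit A_torus) (torus_gen_comm q_neq0 A_torus)).
have e_conj := torus_monomial_conj q_neq0 A_torus.
have e_span := torus_monomial_span q_neq0 A_torus.
have domain := quantum_torus_domain q_neq0 q_nroot e0 eM e_conj e_span.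
have ore := quantum_torus_ore q_neq0 q_nroot e0 eM e_conj e_span.
have simple := quantum_torus_simple q_neq0 q_nroot e0 eM e_conj e_span.
(* The vector [m0] on which the embedding is visibly nonzero also starts the eigenvector
   argument. *)
have [n0 [[m0 m0n0] n0_inj]] :=
  invertible_embeds M_bimod N_bimod betaP betaP' domain ore.
have m0_neq0 : m0 <> 0.
  by move=> m0_0; move: m0n0; rewrite m0_0 (pairing_0l betaP) eqxx.
have z_comm i j : exists k, qcomm q k (torus_gen x y i) (torus_gen x y j).
  by exists (torus_form i j); exact: (torus_gen_comm q_neq0 A_torus).
have [v [v0 vP]] := eigenvector_cyclic q_neq0 q_nroot e0 eM e_conj e_span
  (torus_gen_unit A_torus) z_comm (torus_gen_ind A_torus)
  M_bimod N_bimod betaP betaP' n0_inj m0_neq0.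
exact: (invertible_cyclic M_bimod N_bimod betaP betaP' domain ore simple v0 vP).
Qed.
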